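(* Let $A$ be a linear, selfadjoint, nonnegative, trace class operator on the Hilbert space $H$. There exists a measurable norm $\|\cdot\|_{A,n}$ on $H$, and hence a completion $B_A$ of $H$ with respect to this norm, such that the following property is satisfied: if $f\in S(Q_A)$, then $f$ is uniformly continuous on $H$ with respect to the norm $\|\cdot\|_{A,n}$. The function $f$ admits a uniformly continuous extension $f_A$ on $B_A$, and, for every $h>0$ and $p\in[1,+\infty[$, the stochastic extension $\tilde f$ of $f$ in $L^p(B_A,\mu_{B_A,h})$ is equal to $f_A$ $\mu_{B_A,h}$-almost everywhere.
   Context: $H$ is a real, separable, infinite dimensional Hilbert space with scalar product $\langle\cdot,\cdot\rangle$ and norm $|\cdot|$. A norm $\|\cdot\|$ on $H$ is measurable (Gross) if for every $\eta>0$ there is a finite rank orthogonal projection $P_0$ such that for every finite rank orthogonal projection $P$ with $P\perp P_0$, the standard Gaussian measure of $\{x\in P(H):\|x\|>\eta\}$ on $P(H)$ is less than $\eta$. If $B$ is the completion of $H$ for a measurable norm, $H$ is identified with its dual so that $B'\subset H\subset B$; for $h>0$, $\mu_{B,h}$ is the Gaussian probability measure of variance $h$ on the Borel $\sigma$-algebra of $B$: for $y_1,\dots,y_n\in B'$ orthonormal in $H$, the image of $\mu_{B,h}$ under $x\mapsto(y_1(x),\dots,y_n(x))$ is $(2\pi h)^{-n/2}e^{-|v|^2/(2h)}dv$ on $\mathbb R^n$. For $a\in H$, $\ell_a\in L^2(B,\mu_{B,h})$ is the image of $a$ under the continuous extension to $H$ of the map $B'\ni y\mapsto y(\cdot)$.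 For a finite dimensional subspace $E$ of $H$ with orthonormal basis $(w_1,\dots,w_n)$, $\tilde\pi_E(x)=\sum_j\ell_{w_j}(x)w_j$ for $x\in B$. A Borel function $f$ on $H$ admits $\tilde f$ as a stochastic extension in $L^p(B,\mu_{B,h})$ if, for every increasing sequence $(E_n)$ of finite dimensional subspaces of $H$ with dense union, $f\circ\tilde\pi_{E_n}\in L^p(B,\mu_{B,h})$ and $f\circ\tilde\pi_{E_n}\to\tilde f$ in $L^p(B,\mu_{B,h})$. It is known that every $f\in S(Q_A)$ admits a stochastic extension in $L^p(B,\mu_{B,h})$ for every such $B$, every $h>0$ and $p\in[1,\infty[$. $Q_A(x)=\langle Ax,x\rangle$; $S(Q_A)$ is the class of all $f\in C^\infty(H)$ for which there is $C(f)>0$ with $|f(x)|\le C(f)$ for all $x\in H$ and $|(d^mf)(x)(U_1,\dots,U_m)|\le C(f)\prod_{j=1}^mQ_A(U_j)^{1/2}$ for all $m\in\mathbb N^*$, $x\in H$, $U_1,\dots,U_m\in H$. *)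

(* Defs.v *)
From HB Require Import structures.
From mathcomp Require Import all_boot all_order all_algebra sesquilinear.
From mathcomp Require Import all_classical all_reals all_analysis.

Set Implicit Arguments.
Unset Strict Implicit.
Unset Printing Implicit Defensive.

Import Order.TTheory GRing.Theory Num.Theory.
Import numFieldNormedType.Exports.

Local Open Scope classical_set_scope.
Local Open Scope ring_scope.

(* A real Hilbert space is a [completeNormedModType] [H] together with a
   positive definite symmetric form [ip : {dot H for idfun}] whose square root
   is the norm; this last fact, [forall x, ip x x = `|x| ^+ 2], is an explicit
   hypothesis wherever it is needed. *)

Definition separable_space (T : topologicalType) : Prop :=
  exists2 D : set T, countable D & dense D.

Section LinearAlgebra.
Context {R : realType} {H : completeNormedModType R}.

Definition lspan (n : nat) (w : 'I_n -> H) : set H :=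
  [set x | exists c : 'I_n -> R, x = \sum_(j < n) c j *: w j].

Definition infinite_dimensional : Prop :=
  forall (n : nat) (w : 'I_n -> H), lspan w <> setT.

Variable ip : {dot H for idfun}.

Definition orthonormal_family (I : eqType) (w : I -> H) : Prop :=
  forall j k : I, ip (w j) (w k) = (j == k)%:R.

Definition orthonormal_basis (E : set H) (n : nat) (w : 'I_n -> H) : Prop :=
  orthonormal_family w /\ E = lspan w.

Definition hilbert_basis (e : nat -> H) : Prop :=
  orthonormal_family e /\
  dense (\bigcup_n lspan (fun k : 'I_n => e k)).

Definition selfadjoint (A : H -> H) : Prop :=
  forall x y, ip (A x) y = ip x (A y).

Definition nonnegative_operator (A : H -> H) : Prop :=
  forall x, 0 <= ip (A x) x.

(* Only meant for a nonnegative selfadjoint operator, where [|A| = A] and the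
   (possibly infinite) trace does not depend on the chosen basis. *)
Definition trace_class (A : H -> H) : Prop :=
  exists2 e : nat -> H, hilbert_basis e &
    cvgn (series (fun k => ip (A (e k)) (e k))).

Definition finite_rank_projection (P : {linear H -> H}) : Prop :=
  [/\ forall x, P (P x) = P x, selfadjoint P &
      exists (n : nat) (w : 'I_n -> H), range P `<=` lspan w].

Definition orthogonal_ranges (P Q : H -> H) : Prop :=
  forall x y, ip (P x) (Q y) = 0.

End LinearAlgebra.
Arguments infinite_dimensional {R} H.

Section GaussianRn.
Context {R : realType}.

(* Lebesgue integral on R^n, as an iterated integral (Tonelli); it is used for
   nonnegative measurable integrands only. *)
Fixpoint integral_Rn (n : nat) : (n.-tuple R -> \bar R) -> \bar R :=
  match n with
  | 0 => fun F => F [tuple]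
  | n'.+1 => fun F =>
      (\int[lebesgue_measure]_x integral_Rn (fun v => F [tuple of x :: v]))%E
  end.

Definition gaussian_density (n : nat) (h : R) (v : n.-tuple R) : R :=
  (2 * pi * h) `^ (- (n%:R / 2)) *
  expR (- (\sum_(j < n) tnth v j ^+ 2) / (2 * h)).

Definition gaussian_Rn (n : nat) (h : R) (S : set (n.-tuple R)) : \bar R :=
  integral_Rn (fun v => (gaussian_density h v * \1_S v)%:E).

End GaussianRn.

Section MeasurableNorm.
Context {R : realType} {H : completeNormedModType R}.
Variable ip : {dot H for idfun}.

Definition is_norm (N : H -> R) : Prop :=
  [/\ forall x, N x = 0 -> x = 0,
      forall (a : R) x, N (a *: x) = `|a| * N x &
      forall x y, N (x + y) <= N x + N y].

(* The standard Gaussian measure of the subspace [range P] is the image of the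
   one of R^n by the coordinates in any orthonormal basis of [range P]. *)
Definition measurable_norm (N : H -> R) : Prop :=
  is_norm N /\
  forall eta : R, 0 < eta ->
  exists2 P0 : {linear H -> H}, finite_rank_projection ip P0 &
  forall P : {linear H -> H}, finite_rank_projection ip P ->
  orthogonal_ranges ip P P0 ->
  forall (n : nat) (w : 'I_n -> H), orthonormal_basis ip (range P) w ->
  (gaussian_Rn 1 [set v : n.-tuple R |
     (eta < N (\sum_(j < n) tnth v j *: w j)%R)%R] < eta%:E)%E.

Definition is_completion (N : H -> R) (B : completeNormedModType R)
    (i : {linear H -> B}) : Prop :=
  (forall x, `|i x| = N x) /\ dense (range i).

Definition unif_continuous_wrt (N : H -> R) (f : H -> R) : Prop :=
  forall eps : R, 0 < eps -> exists2 delta : R, 0 < delta &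
    forall x y, N (x - y) < delta -> `|f x - f y| < eps.

End MeasurableNorm.

Section WienerSpace.
Context {R : realType} {H : completeNormedModType R}.
Variable ip : {dot H for idfun}.
Context {B : completeNormedModType R}.
Variable i : {linear H -> B}.

Definition borel_space := g_sigma_algebraType (@open B).

(* The inclusion B' c H: the continuous functional [y] on [B] is identified
   with the vector [a] of [H]. *)
Definition dual_vector (y : {scalar B}) (a : H) : Prop :=
  continuous y /\ forall x, y (i x) = ip a x.

Definition is_gaussian_measure (h : R) (mu : probability borel_space R) : Prop :=
  forall (n : nat) (y : 'I_n -> {scalar B}) (a : 'I_n -> H),
    (forall j, dual_vector (y j) (a j)) -> orthonormal_family ip a ->
    forall S : set (n.-tuple R), measurable S ->
      mu [set x : B | S [tuple y j x | j < n]] = gaussian_Rn h S.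

(* [ell a] is a representative of the class l_a; the three clauses say that
   a |-> l_a is the continuous extension to [H], with values in L^2(B, mu),
   of y |-> y(.) *)
Definition is_ell (mu : probability borel_space R)
    (ell : H -> borel_space -> R) : Prop :=
  [/\ forall a, ell a \in Lfun mu 2%:E,
      forall (y : {scalar B}) (a : H), dual_vector y a ->
        {ae mu, forall x, ell a x = y x} &
      forall a : H,
        ('N[mu]_2%:E[EFin \o (ell b \- ell a)%R] @[b --> a] --> 0)%E].

Definition pi_tilde (ell : H -> borel_space -> R) (n : nat) (w : 'I_n -> H)
    (x : borel_space) : H := \sum_(j < n) ell (w j) x *: w j.

(* L^p elements are given by representatives. The orthonormal bases [w m] are
   arbitrary, changing them only changes pi_tilde on a mu-negligible set. *)
Definition stochastic_extension (mu : probability borel_space R)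
    (ell : H -> borel_space -> R) (p : R) (f : H -> R)
    (ft : borel_space -> R) : Prop :=
  ft \in Lfun mu p%:E /\
  forall (E : nat -> set H) (d : nat -> nat) (w : forall m, 'I_(d m) -> H),
    (forall m, orthonormal_basis ip (E m) (w m)) ->
    (forall m, E m `<=` E m.+1) ->
    dense (\bigcup_m E m) ->
    (forall m, (f \o pi_tilde ell (w m)) \in Lfun mu p%:E) /\
    ('N[mu]_p%:E[EFin \o ((f \o pi_tilde ell (w m)) \- ft)%R] @[m --> \oo]
       --> 0)%E.

End WienerSpace.
Arguments borel_space {R} B.

Section SymbolClass.
Context {R : realType} {H : completeNormedModType R}.

Definition tuple_update (m : nat) (U : m.-tuple H) (j : 'I_m) (v : H) :
  m.-tuple H := [tuple if k == j then v else tnth U k | k < m].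

Definition bounded_multilinear (m : nat) (T : m.-tuple H -> R) : Prop :=
  (forall U j (a : R) v w,
     T (tuple_update U j (a *: v + w)) =
     a * T (tuple_update U j v) + T (tuple_update U j w)) /\
  exists M : R, forall U, `|T U| <= M * \prod_(k < m) `|tnth U k|.

(* [D m x] is the m-th differential of [f] at [x]: the last clause says that
   [D m], with values in the bounded m-linear forms with their operator norm,
   is Frechet differentiable with differential u |-> D m.+1 x (u, ...). *)
Definition frechet_derivatives (f : H -> R)
    (D : forall m : nat, H -> m.-tuple H -> R) : Prop :=
  [/\ forall x, D 0%N x [tuple] = f x,
      forall m x, bounded_multilinear (D m x) &
      forall m x (e : R), 0 < e -> \forall u \near (0 : H),
        forall U : m.-tuple H,
          `|D m (x + u) U - D m x U - D m.+1 x [tuple of u :: U]|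
            <= e * `|u| * \prod_(k < m) `|tnth U k|].

Definition Qform (ip : {dot H for idfun}) (A : H -> H) (x : H) : R :=
  ip (A x) x.

(* [f] is C^infty iff it has a (necessarily unique) sequence [D] of Frechet
   derivatives. *)
Definition S_class (Q : H -> R) (f : H -> R) : Prop :=
  exists2 D : forall m : nat, H -> m.-tuple H -> R, frechet_derivatives f D &
  exists2 C : R, 0 < C &
    (forall x, `|f x| <= C) /\
    (forall (m : nat) x (U : m.-tuple H), (0 < m)%N ->
       `|D m x U| <= C * \prod_(j < m) Num.sqrt (Q (tnth U j))).

End SymbolClass.

(* Main.v *)
(* Let [e] be the Hilbert basis in which the trace is computed and put
   [T = A + D], where [D x = \sum_k 2 ^- k <x, e_k> e_k] makes [T] injective
   without destroying the finite trace. Orthonormalizing [e] for the form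
   [<T x, y>] gives vectors [g_k], and [i x = \sum_k <T x, g_k> e_k] satisfies
   [<i x, i y> = <T x, y>], has dense range, and is Hilbert-Schmidt. Hence [H]
   itself, with the embedding [i], is the completion of [H] for the norm
   [|i x| = sqrt <T x, x> >= sqrt (Q_A x)]; no square root of [T] and no abstract
   completion is needed. The norm is measurable by Chebyshev's inequality,
   because [\sum_j |i w_j|^2] is small for orthonormal [w_j] far out in [H].
   By the mean value theorem [f] is Lipschitz for this norm, and it extends to
   [B = H] by McShane's formula. Finally, the isometry [a |-> l_a] gives
   [E |i (pi_E x) - x|^2 <= 8 h \sum_k |P_E a_k - a_k|^2] with [a_k = i^* e_k]
   square summable, which tends to 0 along increasing [E]; since [f] is bounded
   and Lipschitz, [f o pi_E] converges in [L^p] to the extension.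

   Second moments are only estimated up to the constant 8, which is enough for
   all these convergences. *)

Require Import Defs.
From HB Require Import structures.
From mathcomp Require Import all_boot all_order all_algebra sesquilinear.
From mathcomp Require Import all_classical all_reals all_analysis.
From mathcomp Require Import measurable_realfun.
From mathcomp Require Import ring lra.

Set Implicit Arguments.
Unset Strict Implicit.
Unset Printing Implicit Defensive.

Import Order.TTheory GRing.Theory Num.Theory.
Import numFieldNormedType.Exports.

Local Open Scope classical_set_scope.
Local Open Scope ring_scope.

(** * Inner products *)

(** Definiteness is left out so that Cauchy-Schwarz, Bessel and Parseval can serve three forms: [ip]
    itself, [<T x, y>], and the form of the damped operator [1 - T / M]. *)
Definition is_sip {R : realType} {V : lmodType R} (b : V -> V -> R) : Prop :=
  [/\ forall x y, b x y = b y x,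
      forall (a : R) x y z, b (a *: x + y) z = a * b x z + b y z &
      forall x, 0 <= b x x].

Definition orthonormal_for {R : realType} {V : lmodType R} (b : V -> V -> R)
    (I : eqType) (w : I -> V) : Prop :=
  forall j k : I, b (w j) (w k) = (j == k)%:R.

Section SemiInnerProduct.
Context {R : realType} {V : lmodType R} {b : V -> V -> R}.
Hypothesis bP : is_sip b.

Lemma sipC x y : b x y = b y x. Proof. by case: bP. Qed.

Lemma sip_ge0 x : 0 <= b x x. Proof. by case: bP. Qed.

Lemma sipPl a x y z : b (a *: x + y) z = a * b x z + b y z.
Proof. by case: bP. Qed.

Lemma sipDl x y z : b (x + y) z = b x z + b y z.
Proof. by rewrite -[x]scale1r sipPl mul1r scale1r. Qed.

Lemma sip0l z : b 0 z = 0.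
Proof. by apply: (addrI (b 0 z)); rewrite -sipDl !addr0. Qed.

Lemma sipZl a x z : b (a *: x) z = a * b x z.
Proof. by rewrite -[a *: x]addr0 sipPl sip0l addr0. Qed.

Lemma sipNl x z : b (- x) z = - b x z.
Proof. by rewrite -scaleN1r sipZl mulN1r. Qed.

Lemma sipBl x y z : b (x - y) z = b x z - b y z.
Proof. by rewrite sipDl sipNl. Qed.

Lemma sipDr x y z : b z (x + y) = b z x + b z y.
Proof. by rewrite !(sipC z) sipDl. Qed.

Lemma sipZr a x z : b z (a *: x) = a * b z x.
Proof. by rewrite !(sipC z) sipZl. Qed.

Lemma sip0r z : b z 0 = 0. Proof. by rewrite sipC sip0l. Qed.

Lemma sipBr x y z : b z (x - y) = b z x - b z y.
Proof. by rewrite !(sipC z) sipBl. Qed.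

Lemma sip_suml (I : Type) (r : seq I) (P : pred I) (F : I -> V) z :
  b (\sum_(i <- r | P i) F i) z = \sum_(i <- r | P i) b (F i) z.
Proof.
elim/big_rec2: _ => [|i y1 y2 _ <-]; first exact: sip0l.
by rewrite sipDl.
Qed.

Lemma sip_sumr (I : Type) (r : seq I) (P : pred I) (F : I -> V) z :
  b z (\sum_(i <- r | P i) F i) = \sum_(i <- r | P i) b z (F i).
Proof. by rewrite sipC sip_suml; apply: eq_bigr => i _; rewrite sipC. Qed.

Lemma sipB x y : b (x - y) (x - y) = b x x - 2 * b x y + b y y.
Proof. by rewrite sipBl !sipBr (sipC y x); ring. Qed.

Lemma sipD x y : b (x + y) (x + y) = b x x + 2 * b x y + b y y.
Proof. by rewrite sipDl !sipDr (sipC y x); ring. Qed.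

Lemma sip_CauchySchwarz x y : b x y ^+ 2 <= b x x * b y y.
Proof.
have q t : 0 <= b x x - 2 * t * b x y + t ^+ 2 * b y y.
  have := sip_ge0 (x - t *: y).
  by rewrite sipB sipZl !sipZr; congr (0 <= _); ring.
have [y0|y0] := eqVneq (b y y) 0.
  rewrite y0 mulr0; have [->|xy0] := eqVneq (b x y) 0; first by rewrite expr0n.
  (* When [b y y = 0] the polynomial [q] is affine in [t], and this [t] gives it the value [-1]. *)
  have := q ((b x x + 1) / (2 * b x y)).
  rewrite y0 mulr0 addr0.
  suff -> : 2 * ((b x x + 1) / (2 * b x y)) * b x y = b x x + 1 by lra.
  by field; rewrite xy0.
have yp : 0 < b y y by rewrite lt_def y0 sip_ge0.
have := q (b x y / b y y); rewrite -(ler_pM2r yp) mul0r.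
suff -> : (b x x - 2 * (b x y / b y y) * b x y + (b x y / b y y) ^+ 2 * b y y)
   * b y y = b x x * b y y - b x y ^+ 2 by rewrite subr_ge0.
by field.
Qed.

Section FiniteFamily.
Context {I : finType} {g : I -> V}.
Hypothesis g_on : orthonormal_for b g.

Lemma sip_sum_orthonormal (c : I -> R) j : b (\sum_i c i *: g i) (g j) = c j.
Proof.
rewrite sip_suml (bigD1 j)//= sipZl g_on eqxx mulr1 big1 ?addr0// => i ij.
by rewrite sipZl g_on (negbTE ij) mulr0.
Qed.

(** Completing the square in each [c i]: the choice [c i = b x (g i)] minimizes the residual, and
    both Bessel and best approximation are read off from this identity. *)
Lemma sip_residual x (c : I -> R) :
  b (x - \sum_i c i *: g i) (x - \sum_i c i *: g i) =
  b x x - \sum_i b x (g i) ^+ 2 + \sum_i (c i - b x (g i)) ^+ 2.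
Proof.
rewrite sipB [b (\sum_i _) (\sum_i _)]sip_sumr [b x (\sum_i _)]sip_sumr.
rewrite mulr_sumr -addrA -[RHS]addrA -!sumrN -!big_split/=; congr (_ + _).
by apply: eq_bigr => i _; rewrite !sipZr sip_sum_orthonormal; ring.
Qed.

Lemma sip_residual_min x :
  b (x - \sum_i b x (g i) *: g i) (x - \sum_i b x (g i) *: g i) =
  b x x - \sum_i b x (g i) ^+ 2.
Proof.
rewrite sip_residual [X in _ + X]big1 ?addr0// => i _.
by rewrite subrr expr0n.
Qed.

Lemma sip_bessel x : \sum_i b x (g i) ^+ 2 <= b x x.
Proof. by rewrite -subr_ge0 -sip_residual_min sip_ge0. Qed.

Lemma sip_best_approx x (c : I -> R) :
  b x x - \sum_i b x (g i) ^+ 2 <=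
  b (x - \sum_i c i *: g i) (x - \sum_i c i *: g i).
Proof. by rewrite sip_residual lerDl sumr_ge0// => i _; rewrite sqr_ge0. Qed.

End FiniteFamily.

Section Sequence.
Context {g : nat -> V}.
Hypothesis g_on : orthonormal_for b g.

Lemma orthonormal_ord n : orthonormal_for b (fun k : 'I_n => g k).
Proof. by move=> j k; rewrite g_on. Qed.

Lemma sip_bessel_seq x n : \sum_(k < n) b x (g k) ^+ 2 <= b x x.
Proof. exact: (sip_bessel (@orthonormal_ord n)). Qed.

(** Best approximation turns a good combination of the first [n] vectors into a lower bound on the
    [n]-th partial sum; partial sums increase and Bessel bounds them above. *)
Lemma sip_parseval x :
  (forall eps : R, 0 < eps -> exists n (c : 'I_n -> R),
     b (x - \sum_(k < n) c k *: g k) (x - \sum_(k < n) c k *: g k) < eps) ->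
  series (fun k => b x (g k) ^+ 2) @ \oo --> b x x.
Proof.
move=> xg; apply/cvgrPdist_lt => eps /xg[n [c nc]].
exists n => // m /= nm; rewrite seriesEord/=.
rewrite ger0_norm ?subr_ge0 ?sip_bessel_seq//.
apply: le_lt_trans nc; apply: le_trans (sip_best_approx (@orthonormal_ord n) _ _).
rewrite lerD2l lerN2 -!(big_mkord xpredT (fun k => b x (g k) ^+ 2)).
rewrite [leRHS](big_cat_nat (leq0n n) nm)/= lerDl sumr_ge0// => i _.
by rewrite sqr_ge0.
Qed.

End Sequence.
End SemiInnerProduct.

Section Hilbert.
Context {R : realType} {H : completeNormedModType R} (ip : {dot H for idfun}).
Hypothesis ip_norm : forall x, ip x x = `|x| ^+ 2.

Lemma ip_sip : is_sip (ip : H -> H -> R).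
Proof.
split=> [x y|a x y z|x]; last by rewrite ip_norm sqr_ge0.
  by rewrite hermC expr0 mul1r.
by rewrite linearPl.
Qed.

Lemma ip_le x y : `|ip x y| <= `|x| * `|y|.
Proof.
rewrite -(@ler_pXn2r _ 2)// ?nnegrE ?mulr_ge0//.
rewrite real_normK ?num_real// exprMn -!ip_norm.
exact: (sip_CauchySchwarz ip_sip).
Qed.

Lemma ip_continuous y : continuous (ip ^~ y).
Proof.
move=> x; apply/cvgrPdist_lt => eps eps0.
have y1 : 0 < `|y| + 1 by rewrite ltr_pwDr.
near=> z; rewrite -(sipBl ip_sip).
apply: (le_lt_trans (ip_le _ _)).
apply: (@le_lt_trans _ _ (`|x - z| * (`|y| + 1))).
  by rewrite ler_wpM2l// lerDl.
rewrite -ltr_pdivlMr//; near: z; apply: cvgr_dist_lt => //.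
by rewrite divr_gt0.
Unshelve. all: by end_near. Qed.

(** Riesz-Fischer: by Pythagoras, the squared norm of a block of the series is the corresponding
    block of [c k ^+ 2], so the partial sums are Cauchy. *)
Lemma cvg_series_orthonormal (e : nat -> H) (c : nat -> R) :
  orthonormal_for ip e -> cvgn (series (fun k => c k ^+ 2)) ->
  cvgn (series (fun k => c k *: e k)).
Proof.
move=> eon /cauchy_cvgP/cauchy_seriesP cc.
apply/cauchy_cvgP/cauchy_seriesP => eps eps0.
have := cc (eps ^+ 2) (exprn_gt0 2 eps0); apply: filterS => -[m n]/=.
have -> : \sum_(m <= k < n) c k ^+ 2 = `|\sum_(m <= k < n) c k *: e k| ^+ 2.
  rewrite -ip_norm (sip_suml ip_sip); apply: eq_big_nat => k kmn.
  rewrite (sipZl ip_sip) (sip_sumr ip_sip) (bigD1_seq k)/= ?iota_uniq//; last first.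
    by rewrite mem_index_iota.
  rewrite (sipZr ip_sip) eon eqxx mulr1 big1 ?addr0 ?expr2// => j jk.
  by rewrite (sipZr ip_sip) eon eq_sym (negbTE jk) mulr0.
by rewrite normrX normr_id ltr_pXn2r ?nnegrE// ltW.
Qed.

Lemma dense_approx (S : set H) : dense S ->
  forall x (eps : R), 0 < eps -> exists2 y, S y & `|x - y| < eps.
Proof.
move=> dS x eps eps0.
have [||y [xy Sy]] := dS (ball x eps).
- by exists x; exact: ballxx.
- exact: ball_open.
by exists y => //; move: xy; rewrite -ball_normE.
Qed.

Lemma approx_dense (S : set H) :
  (forall x (eps : R), 0 < eps -> exists2 y, S y & `|x - y| < eps) -> dense S.
Proof.
move=> dS O [x Ox] Oo.
have /nbhs_ballP[eps /= eps0 xO] : nbhs x O by exact: open_nbhs_nbhs.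
have [y Sy xy] := dS x _ eps0.
by exists y; split => //; apply: xO; rewrite -ball_normE.
Qed.

Lemma parseval (e : nat -> H) x : hilbert_basis ip e ->
  series (fun k => ip x (e k) ^+ 2) @ \oo --> `|x| ^+ 2.
Proof.
move=> [eon ed]; rewrite -ip_norm; apply: (sip_parseval ip_sip eon) => eps eps0.
have [|y [n _ [c yE]] xy] := dense_approx ed x (_ : 0 < Num.sqrt eps).
  by rewrite sqrtr_gt0.
exists n, c; rewrite -yE ip_norm.
by rewrite -[eps]sqr_sqrtr ?ltW// ltr_pXn2r ?nnegrE ?sqrtr_ge0.
Qed.

Lemma ip_eq0 x : (forall y, ip x y = 0) -> x = 0.
Proof.
move=> /(_ x); rewrite ip_norm => /eqP; rewrite sqrf_eq0 normr_eq0.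
by move/eqP.
Qed.

End Hilbert.
Arguments ip_continuous {R H ip} ip_norm y x.
Arguments parseval {R H ip} ip_norm {e} x _.

(** * Orthonormalization and synthesis of square-summable coefficients *)

Section GramSchmidt.
Context {R : realType} {V : lmodType R} (b : V -> V -> R) (e : nat -> V).

Definition gs_step (s : seq V) (x : V) : V :=
  let r := x - \sum_(u <- s) b x u *: u in (Num.sqrt (b r r))^-1 *: r.

(** Carrying the list of all vectors built so far makes the recursion structural. *)
Fixpoint gs_prefix (n : nat) : seq V :=
  if n is m.+1 then rcons (gs_prefix m) (gs_step (gs_prefix m) (e m)) else [::].

Definition gram_schmidt (n : nat) : V := gs_step (gs_prefix n) (e n).

Lemma gs_prefixE n : gs_prefix n = [seq gram_schmidt k | k <- index_iota 0 n].
Proof.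
rewrite /index_iota subn0; elim: n => // n IHn.
by rewrite -[X in iota _ X]addn1 iotaD map_cat -IHn /= cats1.
Qed.

Let residual n := e n - \sum_(k < n) b (e n) (gram_schmidt k) *: gram_schmidt k.

Lemma gram_schmidtE n :
  gram_schmidt n = (Num.sqrt (b (residual n) (residual n)))^-1 *: residual n.
Proof.
rewrite {1}/gram_schmidt /gs_step gs_prefixE big_map big_mkord.
by rewrite -/(residual n).
Qed.

Context {b0 : V -> V -> R}.
Hypotheses (bP : is_sip b) (b_def : forall x, b x x = 0 -> x = 0).
Hypotheses (b0P : is_sip b0) (e_on : orthonormal_for b0 e).

(** [gram_schmidt k] combines only [e 0], ..., [e k]. The auxiliary form [b0], for which [e] is
    orthonormal, thus certifies linear independence: the [n]-th residual has [b0]-product 1 with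
    [e n], so it is nonzero. *)
Lemma gram_schmidt_later k m : (k < m)%N -> b0 (gram_schmidt k) (e m) = 0.
Proof.
elim/ltn_ind: k => k IHk km.
rewrite gram_schmidtE (sipZl b0P) (sipBl b0P) e_on ltn_eqF// sub0r.
rewrite (sip_suml b0P) big1 ?oppr0 ?mulr0// => j _.
by rewrite (sipZl b0P) IHk ?mulr0//; apply: ltn_trans km.
Qed.

Let residual_gt0 n : 0 < b (residual n) (residual n).
Proof.
rewrite lt_def (sip_ge0 bP) andbT; apply/eqP => /b_def rn0.
have : b0 (residual n) (e n) = 1.
  rewrite (sipBl b0P) e_on eqxx (sip_suml b0P) big1 ?subr0// => j _.
  by rewrite (sipZl b0P) gram_schmidt_later ?mulr0.
by rewrite rn0 (sip0l b0P) => /esym/eqP; rewrite oner_eq0.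
Qed.

Let gram_schmidt_lt n : forall j k, (j < n)%N -> (k < n)%N ->
  b (gram_schmidt j) (gram_schmidt k) = (j == k)%:R.
Proof.
elim: n => // n IHn.
have ortho k : (k < n)%N -> b (gram_schmidt n) (gram_schmidt k) = 0.
  move=> kn; suff rk0 : b (residual n) (gram_schmidt k) = 0.
    by rewrite gram_schmidtE (sipZl bP) rk0 mulr0.
  rewrite (sipBl bP) (sip_suml bP).
  rewrite (bigD1 (Ordinal kn))//= (sipZl bP) IHn// eqxx mulr1.
  rewrite big1 ?addr0 ?subrr// => j jk.
  rewrite (sipZl bP) IHn//; have /negbTE -> : (j : nat) != k by [].
  by rewrite mulr0.
move=> j k; rewrite !ltnS leq_eqVlt => /predU1P[->|jn];
  rewrite leq_eqVlt => /predU1P[->|kn].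
- rewrite eqxx gram_schmidtE (sipZl bP) (sipZr bP) mulrA -expr2 exprVn.
  by rewrite sqr_sqrtr ?ltW// mulVf// gt_eqF.
- by rewrite ortho// gtn_eqF.
- by rewrite (sipC bP) ortho// ltn_eqF.
- exact: IHn.
Qed.

Lemma gram_schmidt_orthonormal : orthonormal_for b gram_schmidt.
Proof.
by move=> j k; apply: (@gram_schmidt_lt (maxn j k).+1); rewrite ltnS ?leq_maxl ?leq_maxr.
Qed.

Lemma gram_schmidt_span n :
  exists c : 'I_n.+1 -> R, e n = \sum_(k < n.+1) c k *: gram_schmidt k.
Proof.
pose r := Num.sqrt (b (residual n) (residual n)).
exists (fun k => if (k < n)%N then b (e n) (gram_schmidt k) else r).
rewrite big_ord_recr/= ltnn.
under eq_bigr => k _ do rewrite ltn_ord.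
rewrite [X in _ + r *: X]gram_schmidtE scalerA divff ?gt_eqF ?sqrtr_gt0//.
by rewrite scale1r addrC subrK.
Qed.

Lemma gram_schmidt_span_sum n (c : 'I_n -> R) :
  exists c' : 'I_n -> R, \sum_(k < n) c k *: e k = \sum_(k < n) c' k *: gram_schmidt k.
Proof.
elim: n c => [|n IHn] c; first by exists c; rewrite !big_ord0.
have [c1 c1E] := IHn (fun k => c (widen_ord (leqnSn n) k)).
have [c2 c2E] := gram_schmidt_span n.
(* [unlift ord_max] extends the coefficients [c1] by 0 at the new last index. *)
exists (fun k => (if unlift ord_max k is Some j then c1 j else 0) + c ord_max * c2 k).
under [RHS]eq_bigr => k _ do rewrite scalerDl -scalerA.
rewrite big_split/= -scaler_sumr -c2E big_ord_recr/= c1E; congr (_ + _).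
rewrite big_ord_recr/= unlift_none scale0r addr0.
apply: eq_bigr => k _; have -> : widen_ord (leqnSn n) k = lift ord_max k.
  by apply: val_inj; rewrite /= /bump leqNgt ltn_ord.
by rewrite liftK.
Qed.

End GramSchmidt.

Section Synthesis.
Context {R : realType} {H : completeNormedModType R} (ip : {dot H for idfun}).
Hypothesis ip_norm : forall x, ip x x = `|x| ^+ 2.
Context {e : nat -> H} (e_basis : hilbert_basis ip e).
Context {c : nat -> H -> R}.
Hypothesis c_linear : forall k (a : R) x y, c k (a *: x + y) = a * c k x + c k y.
Hypothesis c_sqr : forall x, cvgn (series (fun k => c k x ^+ 2)).

(** The vector with prescribed coordinates [c k x] in the basis [e]. Both the diagonal operator [D]
    and the embedding are built this way. *)
Definition synthesis (x : H) : H := limn (series (fun k => c k x *: e k)).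

Lemma synthesis_cvg x : series (fun k => c k x *: e k) @ \oo --> synthesis x.
Proof. by case: e_basis => eon _; exact: (cvg_series_orthonormal ip_norm eon (@c_sqr x)). Qed.

Lemma synthesisP (a : R) x y :
  synthesis (a *: x + y) = a *: synthesis x + synthesis y.
Proof.
apply/cvg_lim; first exact: norm_hausdorff.
have -> : series (fun k => c k (a *: x + y) *: e k) =
    (fun n => a *: series (fun k => c k x *: e k) n + series (fun k => c k y *: e k) n).
  apply/funext => n; rewrite !seriesEnat/= scaler_sumr -big_split/=.
  by apply: eq_bigr => k _; rewrite c_linear scalerDl scalerA.
by apply: cvgD; [apply: cvgZr|]; exact: synthesis_cvg.
Qed.

Lemma ip_synthesis x y :
  series (fun k => c k x * ip (e k) y) @ \oo --> ip (synthesis x) y.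
Proof.
rewrite (_ : series _ = (ip ^~ y) \o series (fun k => c k x *: e k)).
  apply: (cvg_comp _ _ (@synthesis_cvg x)).
  exact: (ip_continuous ip_norm y (synthesis x)).
apply/funext => n; rewrite !seriesEnat/= (sip_suml (ip_sip ip_norm)).
by apply: eq_bigr => k _; rewrite (sipZl (ip_sip ip_norm)).
Qed.

Lemma ip_synthesis_basis x k : ip (synthesis x) (e k) = c k x.
Proof.
have eon : orthonormal_for ip e by case: e_basis.
have <- := cvg_lim (@Rhausdorff R) (@ip_synthesis x (e k)).
apply: cvg_lim; first exact: Rhausdorff.
apply: cvg_near_cst; exists k.+1 => // n /= kn.
rewrite seriesEord/= (bigD1 (Ordinal kn))//= eon eqxx mulr1 big1 ?addr0// => j jk.
rewrite eon; have /negbTE -> : (j : nat) != k by [].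
by rewrite mulr0.
Qed.

Lemma norm_synthesis x :
  series (fun k => c k x ^+ 2) @ \oo --> `|synthesis x| ^+ 2.
Proof.
have := parseval ip_norm (synthesis x) e_basis.
by under eq_fun do rewrite ip_synthesis_basis.
Qed.

End Synthesis.
Arguments synthesisP {R H ip} ip_norm {e} e_basis {c}.
Arguments ip_synthesis {R H ip} ip_norm {e} e_basis {c} c_sqr x y.
Arguments ip_synthesis_basis {R H ip} ip_norm {e} e_basis {c} c_sqr x k.
Arguments norm_synthesis {R H ip} ip_norm {e} e_basis {c} c_sqr x.
Arguments synthesis {R H} e c x.

(** * Positive injective operators have dense range *)

Section PositiveInjective.
Context {R : realType} {H : completeNormedModType R} {ip : {dot H for idfun}}.
Hypothesis ip_norm : forall x, ip x x = `|x| ^+ 2.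
Context {T : H -> H} {M : R}.
Hypothesis M_gt0 : 0 < M.
Hypothesis T_linear : forall (a : R) x y, T (a *: x + y) = a *: T x + T y.
Hypothesis T_selfadjoint : selfadjoint ip T.
Hypothesis T_ge0 : nonnegative_operator ip T.
Hypothesis T_bounded : forall x, `|T x| <= M * `|x|.
Hypothesis T_def : forall x, ip (T x) x = 0 -> x = 0.

Let ipP := ip_sip ip_norm.

(** [damp = 1 - T / M] lies between 0 and 1 as an operator. Its iterates at [x] will tend to the
    projection of [x] on the kernel of [T], which is 0. *)
Let damp x := x - M^-1 *: T x.

Let dampP (a : R) x y : damp (a *: x + y) = a *: damp x + damp y.
Proof.
rewrite /damp T_linear scalerDr opprD scalerBr !scalerA (mulrC M^-1).
by rewrite addrACA.
Qed.

Let dampB x y : damp (x - y) = damp x - damp y.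
Proof. by rewrite addrC -scaleN1r dampP scaleN1r addrC. Qed.

Let damp_sa x y : ip (damp x) y = ip x (damp y).
Proof.
by rewrite /damp (sipBl ipP) (sipBr ipP) (sipZl ipP) (sipZr ipP) T_selfadjoint.
Qed.

Let dampE x : ip (damp x) x = `|x| ^+ 2 - M^-1 * ip (T x) x.
Proof. by rewrite (sipBl ipP) (sipZl ipP) ip_norm. Qed.

Let damp_sip : is_sip (fun x y => ip (damp x) y).
Proof.
split=> [x y|a x y z|x].
- by rewrite damp_sa (sipC ipP).
- by rewrite dampP (sipDl ipP) (sipZl ipP).
rewrite dampE subr_ge0 mulrC ler_pdivrMr//.
apply: (le_trans (ler_norm _)); apply: (le_trans (ip_le ip_norm _ _)).
by rewrite expr2 mulrAC ler_wpM2r// mulrC.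
Qed.

Let damp_le x : ip (damp x) x <= `|x| ^+ 2.
Proof. by rewrite dampE gerBl mulr_ge0// invr_ge0 ltW. Qed.

(** Cauchy-Schwarz for the form [<damp x, y>], taken at [x] and [damp x], followed by [damp_le]. *)
Let damp_norm x : `|damp x| ^+ 2 <= ip (damp x) x.
Proof.
have [->|d0] := eqVneq `|damp x| 0; first by rewrite expr0n (sip_ge0 damp_sip).
have dp : 0 < `|damp x| ^+ 2 by rewrite exprn_gt0// lt_def d0/=.
rewrite -(ler_pM2r dp) -expr2 -[X in X ^+ 2]ip_norm.
apply: (le_trans (sip_CauchySchwarz damp_sip _ _)).
by rewrite ler_wpM2l// (sip_ge0 damp_sip).
Qed.

Let damp_contr x y : `|damp x - damp y| <= `|x - y|.
Proof.
rewrite -dampB -(@ler_pXn2r _ 2)// ?nnegrE//.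
exact: le_trans (damp_norm _) (damp_le _).
Qed.

Section Iterates.
Variable x : H.

Let u n := iter n damp x.
Let s n := ip (u n) x.

Let ip_iter n m : ip (u n) (u m) = s (n + m).
Proof.
elim: m n => [|m IHm] n; first by rewrite addn0.
by rewrite [u m.+1]iterS -damp_sa -[damp _]/(u n.+1) IHm addSnnS.
Qed.

Let s_even n : s n.*2 = `|u n| ^+ 2.
Proof. by rewrite -addnn -ip_iter ip_norm. Qed.

Let s_odd n : s n.*2.+1 = ip (damp (u n)) (u n).
Proof. by rewrite -addnn -addSn -ip_iter. Qed.

(** The moments [<damp^n x, x>] are nonnegative and decrease: [damp_le] handles the steps from even
    to odd indices, [damp_norm] those from odd to even. *)
Let s_cvg : cvgn s.
Proof.
apply: nonincreasing_is_cvgn.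
  apply/nonincreasing_seqP => n; rewrite -(odd_double_half n).
  case: odd; rewrite ?add0n ?add1n; last by rewrite s_odd s_even damp_le.
  by rewrite s_odd -doubleS s_even damp_norm.
exists 0 => _ [n _ <-]; rewrite -(odd_double_half n).
by case: odd; rewrite ?add0n ?add1n ?s_even ?sqr_ge0// s_odd (sip_ge0 damp_sip).
Qed.

(** [|u n - u m|^2 = s (2n) - 2 s (n + m) + s (2m)], which is small because [s] converges. *)
Let u_cvg : cvgn u.
Proof.
apply/cauchy_cvgP/cauchy_ballP => eps eps0.
have e4 : 0 < eps ^+ 2 / 4 by rewrite divr_gt0// exprn_gt0.
have /cvgrPdist_lt/(_ _ e4)[N _ sN] := s_cvg.
exists (u @` [set n | (N <= n)%N], u @` [set n | (N <= n)%N]) => /=.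
  by split; exists N => // n /= Nn; exists n.
move=> -[_ _]/= [[n Nn <-] [m Nm <-]].
rewrite -ball_normE/= -(@ltr_pXn2r _ 2)// ?nnegrE ?(ltW eps0)//.
rewrite -ip_norm (sipB ipP) !ip_iter.
have := sN (n + n)%N; have := sN (n + m)%N; have := sN (m + m)%N => /=.
have N_ k l : (N <= k)%N -> (N <= k + l)%N by move=> /leq_trans; apply; exact: leq_addr.
move=> /(_ (N_ _ _ Nm)) + /(_ (N_ _ _ Nn)) + /(_ (N_ _ _ Nn)).
by rewrite !ltr_norml => /andP[? ?] /andP[? ?] /andP[? ?]; lra.
Qed.

(** The limit is a fixed point of the contraction [damp], hence is killed by [T], which is
    injective. *)
Let u_lim0 : limn u = 0.
Proof.
set z := limn u; apply: T_def.
suff /eqP : damp z - z = 0.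
  by rewrite /damp addrC addKr oppr_eq0 scaler_eq0 invr_eq0 gt_eqF//= => /eqP ->; rewrite (sip0l ipP).
apply/eqP; rewrite -normr_eq0 eq_le normr_ge0 andbT.
apply/ler_addgt0Pl => eps eps0; rewrite addr0.
have e2 : 0 < eps / 2 by rewrite divr_gt0.
have /cvgrPdist_lt/(_ _ e2)[N _ uN] := u_cvg.
have -> : damp z - z = (damp z - u N.+1) - (z - u N.+1).
  by rewrite (opprB z) subrKA.
apply: (le_trans (ler_normB _ _)); rewrite [leRHS](splitr eps).
apply: lerD; first by apply: (le_trans (damp_contr z (u N))); exact/ltW/(uN _ (leqnn N)).
exact/ltW/(uN _ (leqnSn N)).
Qed.

(** Each iteration subtracts [M^-1 *: T (u n)], so [x - u n] telescopes to a value of [T], while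
    [u n] tends to 0. *)
Lemma positive_injective_range (eps : R) : 0 < eps -> exists w, `|x - T w| < eps.
Proof.
move=> eps0; have T0 : T 0 = 0.
  by have /esym := T_linear 1 0 0; rewrite !scale1r addr0 -[RHS]addr0 => /addrI.
have xu n : exists w, x - u n = T w.
  elim: n => [|n [w IHn]]; first by exists 0; rewrite subrr T0.
  exists (M^-1 *: u n + w).
  have -> : u n.+1 = u n - M^-1 *: T (u n) by [].
  by rewrite T_linear -IHn opprD opprK addrA addrC.
have /cvgrPdist_lt/(_ _ eps0)[N _ uN] := u_cvg.
have [w wE] := xu N; exists w; rewrite -wE opprB addrC subrK.
by have := uN _ (leqnn N); rewrite /= u_lim0 sub0r normrN.
Qed.

End Iterates.
End PositiveInjective.

(** * The embedding *)

Lemma linear_bundle {R : realType} {U W : lmodType R} (f : U -> W) :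
  (forall (a : R) x y, f (a *: x + y) = a *: f x + f y) ->
  exists F : {linear U -> W}, (F : U -> W) = f.
Proof.
move=> fP; pose m := GRing.isLinear.Build R U W *:%R f fP.
by exists (HB.pack_for {linear U -> W} f m).
Qed.

(* [T] plays the role of [i^* i]. *)
Record wiener_embedding {R : realType} {H : completeNormedModType R}
    (ip : {dot H for idfun}) (A : H -> H) (e : nat -> H) (T : H -> H)
    (i : {linear H -> H}) : Prop := WienerEmbedding {
  we_basis : hilbert_basis ip e;
  we_adjoint : forall x z, ip (i x) (i z) = ip x (T z);
  we_dominates : forall x, Qform ip A x <= `|i x| ^+ 2;
  we_injective : forall x, i x = 0 -> x = 0;
  we_hilbert_schmidt : cvgn (series (fun k => `|i (e k)| ^+ 2));
  we_onto_basis : forall k, exists z, i z = e k;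
  we_dense_adjoint : forall x (eps : R), 0 < eps -> exists w, `|x - T w| < eps }.

Section Factorization.
Context {R : realType} {H : completeNormedModType R} {ip : {dot H for idfun}}.
Hypothesis ip_norm : forall x, ip x x = `|x| ^+ 2.
Context {A : {linear H -> H}} {e : nat -> H}.
Hypothesis A_continuous : continuous A.
Hypothesis A_selfadjoint : selfadjoint ip A.
Hypothesis A_nonnegative : nonnegative_operator ip A.
Hypothesis e_basis : hilbert_basis ip e.
Hypothesis A_trace : cvgn (series (fun k => ip (A (e k)) (e k))).

Let ipP := ip_sip ip_norm.
Let e_on : orthonormal_for ip e. Proof. by case: e_basis. Qed.

Let q (k : nat) : R := 2^-1 ^+ k.

Let q_gt0 k : 0 < q k. Proof. by rewrite exprn_gt0// invr_gt0. Qed.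

Let q_le1 k : q k <= 1.
Proof. by rewrite exprn_ile1// ?invr_ge0// invf_le1// ler1n. Qed.

Let q_series : cvgn (series q).
Proof.
have : cvgn (series (geometric 1 (2^-1 : R))).
  by apply: is_cvg_geometric_series; rewrite ger0_norm ?invr_ge0// invf_lt1// ltr1n.
by congr (cvgn (series _)); apply/funext => k /=; rewrite mul1r.
Qed.

Let cD k x := q k * ip x (e k).

Let cD_linear k (a : R) x y : cD k (a *: x + y) = a * cD k x + cD k y.
Proof. by rewrite /cD (sipPl ipP); ring. Qed.

Let cD_le k x : cD k x ^+ 2 <= ip x (e k) ^+ 2.
Proof. by rewrite exprMn ler_piMl ?sqr_ge0// exprn_ile1// ltW. Qed.

Let cD_sqr x : cvgn (series (fun k => cD k x ^+ 2)).
Proof.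
have h : cvgn (series (fun k => ip x (e k) ^+ 2)).
  by apply/cvg_ex; exists (`|x| ^+ 2); exact: parseval.
by apply: (series_le_cvg _ _ _ h) => k; rewrite ?sqr_ge0// cD_le.
Qed.

Let D := synthesis e cD.

Let D_cvg x y : series (fun k => q k * (ip x (e k) * ip y (e k))) @ \oo --> ip (D x) y.
Proof.
have := ip_synthesis ip_norm e_basis cD_sqr x y.
by under [X in series X]eq_fun do rewrite /cD -mulrA (sipC ipP (e _)).
Qed.

Let D_sa x y : ip (D x) y = ip x (D y).
Proof.
rewrite [RHS](sipC ipP) -(cvg_lim (@Rhausdorff R) (@D_cvg x y)).
rewrite -(cvg_lim (@Rhausdorff R) (@D_cvg y x)).
by under [in LHS]eq_fun do rewrite [_ * ip y _]mulrC.
Qed.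

(** One term of a nonnegative series. As [q k > 0], it forces every coordinate of [x] to vanish when
    [<T x, x> = 0]; this is how [D] makes [T] injective. *)
Let D_ge k x : q k * ip x (e k) ^+ 2 <= ip (D x) x.
Proof.
rewrite -(cvg_lim (@Rhausdorff R) (@D_cvg x x)).
apply: limr_ge; first by apply/cvg_ex; eexists; exact: D_cvg.
exists k.+1 => // n /= kn; rewrite seriesEord/= (bigD1 (Ordinal kn))//= expr2 lerDl.
by rewrite sumr_ge0// => j _; rewrite mulr_ge0 ?(ltW (q_gt0 _))// -expr2 sqr_ge0.
Qed.

Let D_ge0 x : 0 <= ip (D x) x.
Proof. by apply: le_trans (D_ge 0 x); rewrite mulr_ge0 ?sqr_ge0// ltW. Qed.

Let D_norm x : `|D x| <= `|x|.
Proof.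
rewrite -(@ler_pXn2r _ 2)// ?nnegrE//.
rewrite -(cvg_lim (@Rhausdorff R) (norm_synthesis ip_norm e_basis cD_sqr x)).
rewrite -(cvg_lim (@Rhausdorff R) (parseval ip_norm x e_basis)).
apply: ler_lim; first exact: cD_sqr.
  by apply/cvg_ex; exists (`|x| ^+ 2); exact: parseval.
by apply: nearW => n; rewrite !seriesEord/=; apply: ler_sum => k _; exact: cD_le.
Qed.

Let T x := A x + D x.
Let b x y := ip (T x) y.

Let T_linear (a : R) x y : T (a *: x + y) = a *: T x + T y.
Proof.
by rewrite /T linearP /D (synthesisP ip_norm e_basis cD_linear cD_sqr) addrACA scalerDr.
Qed.

Let T_sa : selfadjoint ip T.
Proof. by move=> x y; rewrite (sipDl ipP) (sipDr ipP) A_selfadjoint D_sa. Qed.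

Let T_ge0 : nonnegative_operator ip T.
Proof. by move=> x; rewrite (sipDl ipP) addr_ge0// A_nonnegative. Qed.

Let bP : is_sip b.
Proof.
split=> [x y|a x y z|x]; last exact: T_ge0.
  by rewrite /b T_sa (sipC ipP).
by rewrite /b T_linear (sipPl ipP).
Qed.

Let b_def x : b x x = 0 -> x = 0.
Proof.
move=> bx0; have xe k : ip x (e k) = 0.
  apply/eqP; rewrite -sqrf_eq0 eq_le sqr_ge0 andbT.
  rewrite -(ler_pM2l (q_gt0 k)) mulr0; apply: (le_trans (D_ge _ _)).
  by rewrite -bx0 /b (sipDl ipP) lerDr A_nonnegative.
apply/eqP; rewrite -normr_eq0 -sqrf_eq0; apply/eqP.
rewrite -(cvg_lim (@Rhausdorff R) (parseval ip_norm x e_basis)).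
apply: cvg_lim; first exact: Rhausdorff.
apply: cvg_near_cst; apply: nearW => n; rewrite seriesEord/= big1// => k _.
by rewrite xe expr0n.
Qed.

Let T_bounded : exists2 M : R, 0 < M & forall x, `|T x| <= M * `|x|.
Proof.
have /linear_boundedP/pinfty_ex_gt0[M M0 AM] : bounded_near A (nbhs (0 : H)).
  exact/linear_bounded_continuous.
exists (M + 1) => [|x]; first by rewrite addr_gt0.
by rewrite mulrDl mul1r; apply: (le_trans (ler_normD _ _)); rewrite lerD.
Qed.

Let g := gram_schmidt b e.

Let g_on : orthonormal_for b g.
Proof. exact: (gram_schmidt_orthonormal bP b_def ipP e_on). Qed.

(** Combinations of [e] are dense for the norm, hence also for [b], which satisfies
    [b y y <= M * |y|^2]; Gram-Schmidt rewrites them as combinations of [g]. *)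
Let g_parseval x : series (fun k => b x (g k) ^+ 2) @ \oo --> b x x.
Proof.
apply: (sip_parseval bP g_on) => eps eps0.
have [M M0 TM] := T_bounded.
have r0 : 0 < Num.sqrt (eps / M) by rewrite sqrtr_gt0 divr_gt0.
have [_ [n _ [c ->]] xc] := dense_approx e_basis.2 x r0.
have [c' c'E] := gram_schmidt_span_sum bP b_def ipP e_on c.
exists n, c'; rewrite -c'E; set y := x - _ in xc *.
apply: (le_lt_trans (ler_norm _)); apply: (le_lt_trans (ip_le ip_norm _ _)).
apply: (@le_lt_trans _ _ (M * `|y| ^+ 2)).
  by rewrite expr2 mulrA ler_wpM2r.
rewrite mulrC -ltr_pdivlMr// -[ltRHS]sqr_sqrtr ?divr_ge0 ?ltW//.
by rewrite ltr_pXn2r ?nnegrE ?(ltW r0).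
Qed.

Let ci k x := b x (g k).

Let ci_linear k (a : R) x y : ci k (a *: x + y) = a * ci k x + ci k y.
Proof. by rewrite /ci (sipPl bP). Qed.

Let ci_sqr x : cvgn (series (fun k => ci k x ^+ 2)).
Proof. by apply/cvg_ex; eexists; exact: g_parseval. Qed.

Let i0 := synthesis e ci.

Let i0_norm x : `|i0 x| ^+ 2 = b x x.
Proof.
rewrite -(cvg_lim (@Rhausdorff R) (norm_synthesis ip_norm e_basis ci_sqr x)).
exact: (cvg_lim (@Rhausdorff R) (@g_parseval x)).
Qed.

Let i0_linear (a : R) x y : i0 (a *: x + y) = a *: i0 x + i0 y.
Proof. exact: (synthesisP ip_norm e_basis ci_linear ci_sqr). Qed.

(** Orthonormality of [g] for [b] leaves a single term of the series. Reaching every [e k] is what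
    gives the embedding a dense range. *)
Let i0_g k : i0 (g k) = e k.
Proof.
apply/cvg_lim; first exact: norm_hausdorff.
apply: cvg_near_cst; exists k.+1 => // n /= kn.
rewrite seriesEord/= (bigD1 (Ordinal kn))//= /ci g_on eqxx scale1r.
rewrite big1 ?addr0// => j jk; rewrite g_on eq_sym.
by have /negbTE -> : (j : nat) != k; rewrite ?scale0r.
Qed.

Lemma wiener_embedding_exists : exists T i, wiener_embedding ip A e T i.
Proof.
have [i iE] := linear_bundle i0_linear; exists T, i.
have i_norm x : ip (i x) (i x) = b x x by rewrite ip_norm iE i0_norm.
have [M M0 TM] := T_bounded.
split=> //.
(* Polarization of the norm identity [|i x|^2 = <T x, x>]. *)
- move=> x z; have := i_norm (x + z).
  rewrite linearD (sipD ipP) (sipD bP) !i_norm {4}/b T_sa.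
  by move=> h; lra.
- by move=> x; rewrite iE i0_norm /b (sipDl ipP) lerDl.
- by move=> x ix0; apply: b_def; rewrite -i_norm ix0 (sip0l ipP).
(* [|i e_k|^2 = <A e_k, e_k> + 2^-k]: the trace of [A] plus a geometric series. *)
- suff -> : (fun k => `|i (e k)| ^+ 2) = (fun k => ip (A (e k)) (e k)) + q.
    by rewrite seriesD; exact: is_cvgD.
  apply/funext => k; rewrite iE i0_norm /b (sipDl ipP).
  rewrite -[RHS]/(ip (A (e k)) (e k) + q k); congr (_ + _).
  by rewrite /D (ip_synthesis_basis ip_norm e_basis cD_sqr) /cD e_on eqxx mulr1.
- by move=> k; exists (g k); rewrite iE i0_g.
- move=> x eps eps0.
  by have [w] := positive_injective_range ip_norm M0 T_linear T_sa T_ge0 TM b_def x eps0; exists w.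
Qed.

End Factorization.

(** * Finite rank approximation *)

Lemma cvg_sumr {R : realType} (I : Type) (r : seq I) (F : I -> nat -> R) (l : I -> R) :
  (forall i, F i @ \oo --> l i) ->
  (fun n => \sum_(i <- r) F i n) @ \oo --> \sum_(i <- r) l i.
Proof.
move=> Fl; elim: r => [|i r IHr].
  by under eq_fun do rewrite big_nil; rewrite big_nil; exact: cvg_cst.
by under eq_fun do rewrite big_cons; rewrite big_cons; exact: cvgD.
Qed.

Section FiniteRankApproximation.
Context {R : realType} {H : completeNormedModType R} {ip : {dot H for idfun}}.
Hypothesis ip_norm : forall x, ip x x = `|x| ^+ 2.

Let ipP := ip_sip ip_norm.

(** For orthonormal [w], the squared distance from [a] to the span of [w]. *)
Definition defect (n : nat) (w : 'I_n -> H) (a : H) : R :=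
  `|a| ^+ 2 - \sum_(j < n) ip a (w j) ^+ 2.

Lemma defect_ge0 n (w : 'I_n -> H) a : orthonormal_for ip w -> 0 <= defect w a.
Proof. by move=> won; rewrite subr_ge0 -ip_norm; exact: sip_bessel. Qed.

Lemma defect_le n (w : 'I_n -> H) a : defect w a <= `|a| ^+ 2.
Proof. by rewrite lerBlDr lerDl sumr_ge0// => j _; rewrite sqr_ge0. Qed.

Lemma defectE n (w : 'I_n -> H) a : orthonormal_for ip w ->
  defect w a = `|a - \sum_(j < n) ip a (w j) *: w j| ^+ 2.
Proof. by move=> won; rewrite -ip_norm (sip_residual_min ipP won) ip_norm. Qed.

Context {E : nat -> set H} {d : nat -> nat} {w : forall m, 'I_(d m) -> H}.
Hypothesis Ew : forall m, orthonormal_basis ip (E m) (@w m).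
Hypothesis E_incr : forall m, E m `<=` E m.+1.
Hypothesis E_dense : dense (\bigcup_m E m).

(** A vector [v] of the union close to [a] belongs to all [E m] from some rank on, and there best
    approximation bounds the defect by [|a - v|^2]. *)
Lemma defect_cvg a (eps : R) : 0 < eps -> \forall m \near \oo, defect (@w m) a < eps.
Proof.
move=> eps0; have r0 : 0 < Num.sqrt eps by rewrite sqrtr_gt0.
have [v [N _ vN] av] := dense_approx E_dense a r0.
have vE m : (N <= m)%N -> E m v.
  move=> /subnK <-; elim: (m - N)%N => // k IHk.
  by rewrite addSn; exact: E_incr.
exists N => // m /= /vE; have [won ->] := Ew m => -[c vc].
apply: (le_lt_trans (y := `|a - v| ^+ 2)).
  rewrite vc -!ip_norm /defect -ip_norm; exact: (sip_best_approx ipP won).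
by rewrite -[eps]sqr_sqrtr ?ltW// ltr_pXn2r ?nnegrE ?(ltW r0).
Qed.

(** Dominated convergence for series: the tails are controlled uniformly in [m] by those of
    [|a k|^2], and finitely many terms remain for [defect_cvg]. *)
Lemma sum_defect_cvg (a : nat -> H) (eps : R) :
  cvgn (series (fun k => `|a k| ^+ 2)) -> 0 < eps ->
  \forall m \near \oo, forall K, \sum_(0 <= k < K) defect (@w m) (a k) <= eps.
Proof.
move=> /cauchy_cvgP/cauchy_seriesP sa eps0.
have e2 : 0 < eps / 2 by rewrite divr_gt0.
have [[A B] [[N1 _ AN] [N2 _ BN]] AB] := sa _ e2.
pose N := maxn N1 N2.
have tailN K : \sum_(N <= k < K) `|a k| ^+ 2 <= eps / 2.
  have [KN|/ltnW NK] := leqP K N; first by rewrite big_geq// ltW.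
  apply: (le_trans (ler_norm _)); apply/ltW/(AB (N, K)); split => /=.
    by apply: AN; rewrite /= leq_maxl.
  by apply: BN; rewrite /= (leq_trans _ NK)// leq_maxr.
(* [N.+1] rather than [N], since the head may be empty. *)
have e3 : 0 < eps / 2 / N.+1%:R by rewrite divr_gt0.
have : \forall m \near \oo, forall k : 'I_N, defect (@w m) (a k) < eps / 2 / N.+1%:R.
  by apply: filter_forall => k; exact: defect_cvg.
apply: filterS => m mN K; have [won _] := Ew m.
have head : \sum_(0 <= k < N) defect (@w m) (a k) <= eps / 2.
  rewrite big_mkord; apply: (@le_trans _ _ (\sum_(k < N) eps / 2 / N.+1%:R)).
    by apply: ler_sum => k _; exact/ltW/mN.
  rewrite sumr_const card_ord -[_ *+ N]mulr_natr mulrAC ler_pdivrMr ?ltr0n//.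
  by rewrite ler_wpM2l ?ler_nat// ltW.
have defect_sum0 p q : 0 <= \sum_(p <= k < q) defect (@w m) (a k).
  by rewrite sumr_ge0// => k _; exact: defect_ge0.
apply: (@le_trans _ _ (\sum_(0 <= k < maxn K N) defect (@w m) (a k))).
  by rewrite [leRHS](big_cat_nat (leq0n K) (leq_maxl _ _))/= lerDl.
rewrite (big_cat_nat (leq0n N) (leq_maxr _ _))/= (splitr eps) lerD//.
by apply: le_trans (tailN (maxn K N)); apply: ler_sum => k _; exact: defect_le.
Qed.

End FiniteRankApproximation.

Section BasisSpans.
Context {R : realType} {H : completeNormedModType R} {ip : {dot H for idfun}}.
Context {e : nat -> H} (e_basis : hilbert_basis ip e).

Lemma orthonormal_basis_span n :
  orthonormal_basis ip (lspan (fun k : 'I_n => e k)) (fun k : 'I_n => e k).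
Proof. by split=> // j k; case: e_basis => eon _; rewrite eon. Qed.

Lemma lspan_incr n :
  lspan (fun k : 'I_n => e k) `<=` lspan (fun k : 'I_n.+1 => e k).
Proof.
move=> _ [c ->].
exists (fun k => if unlift ord_max k is Some j then c j else 0).
rewrite big_ord_recr/= unlift_none scale0r addr0.
apply: eq_bigr => k _; have -> : widen_ord (leqnSn n) k = lift ord_max k.
  by apply: val_inj; rewrite /= /bump leqNgt ltn_ord.
by rewrite liftK.
Qed.

End BasisSpans.

Lemma mem_lspan {R : realType} {H : completeNormedModType R} n (w : 'I_n -> H) j :
  lspan w (w j).
Proof.
exists (fun k => (k == j)%:R); rewrite (bigD1 j)//= eqxx scale1r.
by rewrite big1 ?addr0// => k /negbTE ->; rewrite scale0r.
Qed.

Section HilbertSchmidtAdjoint.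
Context {R : realType} {H : completeNormedModType R} {ip : {dot H for idfun}}.
Hypothesis ip_norm : forall x, ip x x = `|x| ^+ 2.
Context {A T : H -> H} {e : nat -> H} {i : {linear H -> H}}.
Hypothesis iW : wiener_embedding ip A e T i.
Context {z : nat -> H} (iz : forall k, i (z k) = e k).

Let ipP := ip_sip ip_norm.
Let e_on : orthonormal_for ip e. Proof. by case: (we_basis iW). Qed.

(** This identifies [T (z k)] with the image of [e k] under the adjoint of [i]; it is written in
    this form from here on. *)
Lemma ip_embedding_basis x k : ip (i x) (e k) = ip x (T (z k)).
Proof. by rewrite -iz (we_adjoint iW). Qed.

(** [i] and its adjoint have the same Hilbert-Schmidt norm. Expanding [T (z k)] in the basis and
    exchanging the finite sums leaves [<i e_l, e_k>^2] summed over [k], which Bessel bounds by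
    [|i e_l|^2]. *)
Lemma hilbert_schmidt_adjoint : cvgn (series (fun k => `|T (z k)| ^+ 2)).
Proof.
apply: nondecreasing_is_cvgn; first by apply: nondecreasing_series => k _; rewrite sqr_ge0.
exists (limn (series (fun k => `|i (e k)| ^+ 2))) => _ [K _ <-].
have Tz k : series (fun l => ip (T (z k)) (e l) ^+ 2) @ \oo --> `|T (z k)| ^+ 2.
  exact: (parseval ip_norm (T (z k)) (we_basis iW)).
have sumTz := @cvg_sumr _ _ (index_iota 0 K) _ _ Tz.
rewrite seriesEnat/= -(cvg_lim (@Rhausdorff R) sumTz).
apply: limr_le; first by apply/cvg_ex; eexists; exact: sumTz.
apply: nearW => L; under eq_bigr do rewrite seriesEnat/=.
rewrite exchange_big/=.
apply: (@le_trans _ _ (series (fun k => `|i (e k)| ^+ 2) L)); last first.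
  apply: nondecreasing_cvgn_le; last exact: (we_hilbert_schmidt iW).
  by apply: nondecreasing_series => k _; rewrite sqr_ge0.
rewrite seriesEnat/=; apply: ler_sum => l _.
rewrite big_mkord -ip_norm; under eq_bigr => k _ do rewrite (sipC ipP) -ip_embedding_basis.
exact: (sip_bessel_seq ipP e_on).
Qed.

(** By Parseval, with coordinates [<i w_j, e_k> = <w_j, T z_k>]: a bound on all finite sums over [k]
    passes to the limit. *)
Lemma sum_norm_embedding_le n (w : 'I_n -> H) (M : R) :
  (forall K, \sum_(0 <= k < K) \sum_(j < n) ip (w j) (T (z k)) ^+ 2 <= M) ->
  \sum_(j < n) `|i (w j)| ^+ 2 <= M.
Proof.
move=> wM.
have iw j : series (fun k => ip (w j) (T (z k)) ^+ 2) @ \oo --> `|i (w j)| ^+ 2.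
  have := parseval ip_norm (i (w j)) (we_basis iW).
  by under eq_fun do rewrite ip_embedding_basis.
have sumiw := @cvg_sumr _ _ (index_enum 'I_n) _ _ iw.
rewrite -(cvg_lim (@Rhausdorff R) sumiw).
apply: limr_le; first by apply/cvg_ex; eexists; exact: sumiw.
apply: nearW => K; apply: le_trans (wM K); rewrite exchange_big/=.
exact: ler_sum.
Qed.

End HilbertSchmidtAdjoint.

(** * Gaussian integrals *)

Section IntegralNonMeasurable.
Context {d : measure_display} {T : measurableType d} {R : realType}.
Context (mu : {measure set T -> \bar R}).
Local Open Scope ereal_scope.

(* Holds for arbitrary functions because the integral of a nonnegative function
   is the supremum of the integrals of the simple functions below it. *)
Lemma le_integral_ge0 (f g : T -> \bar R) :
  (forall x, 0 <= f x) -> (forall x, f x <= g x) ->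
  \int[mu]_x f x <= \int[mu]_x g x.
Proof.
move=> f0 fg; have g0 x : 0 <= g x by exact: le_trans (f0 x) (fg x).
rewrite !ge0_integralTE//; apply: le_ereal_sup => _ [h hf <-].
by exists h => // x; exact: le_trans (hf x) (fg x).
Qed.

End IntegralNonMeasurable.

Section IntegralRn.
Context {R : realType}.
Local Open Scope ereal_scope.

Lemma integral_Rn_ge0 n (F : n.-tuple R -> \bar R) :
  (forall v, 0 <= F v) -> 0 <= integral_Rn F.
Proof.
elim: n F => [|n IHn] F F0 /=; first exact: F0.
by apply: integral_ge0 => x _; apply: IHn => v.
Qed.

Lemma le_integral_Rn n (F G : n.-tuple R -> \bar R) :
  (forall v, 0 <= F v) -> (forall v, F v <= G v) ->
  integral_Rn F <= integral_Rn G.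
Proof.
elim: n F G => [|n IHn] F G F0 FG /=; first exact: FG.
apply: le_integral_ge0 => x; first by apply: integral_Rn_ge0 => v.
by apply: IHn => v.
Qed.

End IntegralRn.

Section Gaussian1.
Context {R : realType}.

(** [h] is a variance while [normal_pdf] takes a standard deviation, hence the square root. *)
Definition gauss1 (h x : R) : R := normal_pdf 0 (Num.sqrt h) x.

Lemma gauss1_ge0 h x : 0 <= gauss1 h x.
Proof. exact: normal_pdf_ge0. Qed.

Lemma measurable_gauss1 h : measurable_fun [set: R] (gauss1 h).
Proof. exact: measurable_normal_pdf. Qed.

Lemma gauss1E (h x : R) : 0 < h ->
  gauss1 h x = (Num.sqrt (2 * pi * h))^-1 * expR (- x ^+ 2 / (2 * h)).
Proof.
move=> h0; rewrite /gauss1 normal_pdfE ?gt_eqF ?sqrtr_gt0//.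
rewrite /normal_peak /normal_fun sqr_sqrtr ?ltW// subr0.
by congr ((Num.sqrt _)^-1 * expR (_ / _)); rewrite -mulr_natl; ring.
Qed.

Lemma gauss1N (h x : R) : 0 < h -> gauss1 h (- x) = gauss1 h x.
Proof. by move=> h0; rewrite !gauss1E// sqrrN. Qed.

Lemma integral_gauss1 (h : R) : (\int[lebesgue_measure]_x (gauss1 h x)%:E = 1)%E.
Proof. exact: integral_normal_pdf. Qed.

(* [t <= expR t] at [t = x ^+ 2 / (4 * h)] trades the weight [x ^+ 2] for a
   doubling of the variance. *)
Lemma gauss1_sqr_le (h x : R) : 0 < h ->
  x ^+ 2 * gauss1 h x <= 8 * h * gauss1 (2 * h) x.
Proof.
move=> h0; have h20 : 0 < 2 * h by rewrite mulr_gt0.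
have p0 : 0 < 2 * pi * h by rewrite mulr_gt0// mulr_gt0// pi_gt0.
rewrite !gauss1E//.
have -> : Num.sqrt (2 * pi * (2 * h)) = Num.sqrt 2 * Num.sqrt (2 * pi * h).
  by rewrite -sqrtrM//; congr Num.sqrt; ring.
set s := Num.sqrt (2 * pi * h); have s0 : 0 < s by rewrite sqrtr_gt0.
(* This rounds the factor [4 * sqrt 2] up to 8. *)
have s2 : Num.sqrt 2 <= 2 :> R.
  rewrite -[leRHS]ger0_norm// -sqrtr_sqr ler_wsqrtr//.
  by rewrite expr2 ler_peMl// ler1n.
have s20 : 0 < Num.sqrt 2 :> R by rewrite sqrtr_gt0.
set t := x ^+ 2 / (4 * h).
have -> : - x ^+ 2 / (2 * h) = - t + - t by rewrite /t; field; rewrite gt_eqF.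
have -> : - x ^+ 2 / (2 * (2 * h)) = - t by rewrite /t; field; rewrite gt_eqF.
have -> : x ^+ 2 = 4 * h * t by rewrite /t; field; rewrite gt_eqF.
have t0 : 0 <= t by rewrite divr_ge0 ?sqr_ge0// mulr_ge0// ltW.
have te : t * expR (- t) <= 1.
  rewrite expRN ler_pdivrMr ?expR_gt0// mul1r.
  by apply: le_trans (expR_ge1Dx t); rewrite lerDr.
rewrite expRD invfM.
have -> : 4 * h * t * (s^-1 * (expR (- t) * expR (- t))) =
   (t * expR (- t)) * (4 * h * s^-1 * expR (- t)) by ring.
have -> : 8 * h * ((Num.sqrt 2)^-1 * s^-1 * expR (- t)) =
   (2 / Num.sqrt 2) * (4 * h * s^-1 * expR (- t)) by ring.
apply: ler_wpM2r; first by rewrite !mulr_ge0 ?invr_ge0 ?expR_ge0// ltW.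
by apply: (le_trans te); rewrite ler_pdivlMr// mul1r.
Qed.

Lemma integral_gauss1_sqr (h : R) : 0 < h ->
  (\int[lebesgue_measure]_x (x ^+ 2 * gauss1 h x)%:E <= (8 * h)%:E)%E.
Proof.
move=> h0.
apply: (@le_trans _ _ (\int[lebesgue_measure]_x ((8 * h)%:E * (gauss1 (2 * h) x)%:E))%E).
  apply: le_integral_ge0 => x; first by rewrite lee_fin mulr_ge0 ?sqr_ge0 ?gauss1_ge0.
  by rewrite -EFinM lee_fin gauss1_sqr_le.
rewrite ge0_integralZl ?lee_fin ?mulr_ge0 ?(ltW h0)//.
- by rewrite integral_gauss1 mule1.
- by apply/measurable_EFinP; exact: measurable_gauss1.
- by move=> x _; rewrite lee_fin gauss1_ge0.
Qed.

Lemma integral_gauss1_affine (h a b : R) : 0 < h -> 0 <= a -> 0 <= b ->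
  (\int[lebesgue_measure]_x ((a + b * x ^+ 2) * gauss1 h x)%:E <=
   (a + 8 * h * b)%:E)%E.
Proof.
move=> h0 a0 b0.
have mg : measurable_fun [set: R] (fun x => (gauss1 h x)%:E).
  by apply/measurable_EFinP; exact: measurable_gauss1.
have mg2 : measurable_fun [set: R] (fun x => (x ^+ 2 * gauss1 h x)%:E).
  by apply/measurable_EFinP; apply: measurable_funM => //; exact: measurable_gauss1.
have g0 x : (0 <= (gauss1 h x)%:E)%E by rewrite lee_fin gauss1_ge0.
have g20 x : (0 <= (x ^+ 2 * gauss1 h x)%:E)%E.
  by rewrite lee_fin mulr_ge0 ?sqr_ge0 ?gauss1_ge0.
under eq_integral => x _.
  have -> : ((a + b * x ^+ 2) * gauss1 h x)%:E =
      (a%:E * (gauss1 h x)%:E + b%:E * (x ^+ 2 * gauss1 h x)%:E)%E.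
    by rewrite -!EFinM -EFinD; congr EFin; ring.
  over.
rewrite ge0_integralD//; last 4 first.
- by move=> x _; apply: mule_ge0.
- exact: emeasurable_funM.
- by move=> x _; apply: mule_ge0.
- exact: emeasurable_funM.
rewrite !ge0_integralZl ?lee_fin//.
rewrite EFinD integral_gauss1 mule1 leeD2l// mulrC EFinM.
by rewrite lee_pmul ?lee_fin ?integral_gauss1_sqr ?integral_ge0.
Qed.

(* Averaging over [x] and [- x] removes the odd terms. *)
Lemma integral_symmetrize (F G : R -> R) :
  measurable_fun [set: R] F -> (forall x, 0 <= F x) ->
  (forall x, F x + F (- x) = 2 * G x) ->
  (\int[lebesgue_measure]_x (F x)%:E = \int[lebesgue_measure]_x (G x)%:E)%E.
Proof.
move=> mF F0 FG.
have mN : measurable_fun [set: R] (-%R : R -> measurableTypeR R).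
  exact: oppr_measurable.
have mFN : measurable_fun [set: R] (fun x => F (- x)) by exact: measurableT_comp mN.
have FN : (\int[lebesgue_measure]_x (F x)%:E = \int[lebesgue_measure]_x (F (- x))%:E)%E.
  transitivity (\int[pushforward lebesgue_measure (-%R : R -> measurableTypeR R)]_x (F x)%:E)%E.
    by apply: eq_measure_integral => S mS _; exact/esym/lebesgue_measureN.
  rewrite ge0_integral_pushforward//; first exact/measurable_EFinP.
  by move=> x _; rewrite lee_fin.
under [RHS]eq_integral => x _.
  have -> : (G x)%:E = (2^-1%:E * ((F x)%:E + (F (- x))%:E))%E.
    by rewrite -EFinD FG -EFinM mulKf.
  over.
rewrite ge0_integralZl//; last 2 first.
- by under eq_fun do rewrite -EFinD; apply/measurable_EFinP; exact: measurable_funD.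
- by move=> x _; rewrite adde_ge0// lee_fin.
rewrite ge0_integralD//; last 4 first.
- by move=> x _; rewrite lee_fin.
- exact/measurable_EFinP.
- by move=> x _; rewrite lee_fin.
- exact/measurable_EFinP.
rewrite -FN -mule2n -[X in (_ * X)%E]mule_natl muleA -EFinM mulVf ?pnatr_eq0//.
by rewrite mul1e.
Qed.

End Gaussian1.

Section GaussianQuadratic.
Context {R : realType} {H : completeNormedModType R} {ip : {dot H for idfun}}.
Hypothesis ip_norm : forall x, ip x x = `|x| ^+ 2.

Let ipP := ip_sip ip_norm.

Lemma gaussian_density_cons n (h : R) x (v : n.-tuple R) : 0 < h ->
  gaussian_density h [tuple of x :: v] = gauss1 h x * gaussian_density h v.
Proof.
move=> h0; have p0 : 0 < 2 * pi * h by rewrite mulr_gt0// mulr_gt0// pi_gt0.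
rewrite /gaussian_density gauss1E// big_ord_recl tnth0.
under eq_bigr => j _ do rewrite tnthS.
have expD S : expR (- (x ^+ 2 + S) / (2 * h)) =
    expR (- x ^+ 2 / (2 * h)) * expR (- S / (2 * h)).
  by rewrite -expRD opprD mulrDl.
rewrite expD.
have -> : - (n.+1%:R / 2 : R) = - 2^-1 + - (n%:R / 2).
  by rewrite -natr1 mulrDl mul1r opprD addrC.
rewrite powRD ?(gt_eqF p0) ?implybT// powRN powR12_sqrt ?(ltW p0)//.
by ring.
Qed.

Lemma gaussian_density0 (h : R) (v : 0.-tuple R) : gaussian_density h v = 1.
Proof.
by rewrite /gaussian_density big_ord0 mul0r oppr0 powRr0 mul1r mul0r expR0.
Qed.

Lemma gaussian_density_ge0 n (h : R) (v : n.-tuple R) : 0 <= gaussian_density h v.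
Proof. by rewrite mulr_ge0 ?powR_ge0 ?expR_ge0. Qed.

(** Induction on the number of variables: the shift [c] and the factor [k] hold what the outer
    coordinates, fixed in the inner integral, contribute. The cross term [2 * x * <c, w_0>] is odd
    in [x] and disappears by symmetrization. *)
Lemma integral_gaussian_sqr_norm n (h k : R) (c : H) (w : 'I_n -> H) :
  0 < h -> 0 <= k ->
  (integral_Rn (fun v : n.-tuple R =>
     (k * (gaussian_density h v * `|c + \sum_(j < n) tnth v j *: w j| ^+ 2))%:E)
   <= (k * (`|c| ^+ 2 + 8 * h * \sum_(j < n) `|w j| ^+ 2))%:E)%E.
Proof.
move=> h0; elim: n k c w => [|n IHn] k c w k0 /=.
  by rewrite gaussian_density0 !big_ord0 addr0 mulr0 addr0 mul1r.
set s := \sum_(j < n) `|w (lift ord0 j)| ^+ 2.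
have s0 : 0 <= s by apply: sumr_ge0 => j _; rewrite sqr_ge0.
pose F x := k * gauss1 h x * (`|c + x *: w ord0| ^+ 2 + 8 * h * s).
apply: (@le_trans _ _ (\int[lebesgue_measure]_x (F x)%:E)%E).
  apply: le_integral_ge0 => x.
    by apply: integral_Rn_ge0 => v; rewrite lee_fin mulr_ge0// mulr_ge0 ?gaussian_density_ge0 ?sqr_ge0.
  have kx : 0 <= k * gauss1 h x by rewrite mulr_ge0 ?gauss1_ge0.
  apply: le_trans (IHn _ (c + x *: w ord0) (fun j => w (lift ord0 j)) kx).
  apply: le_integral_Rn => v.
    by rewrite lee_fin mulr_ge0// mulr_ge0 ?gaussian_density_ge0 ?sqr_ge0.
  rewrite lee_fin gaussian_density_cons// big_ord_recl tnth0.
  under eq_bigr => j _ do rewrite tnthS.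
  by rewrite addrA !mulrA.
pose G x := (k * (`|c| ^+ 2 + 8 * h * s) + k * `|w ord0| ^+ 2 * x ^+ 2) * gauss1 h x.
have FE x : F x = k * gauss1 h x *
    (`|c| ^+ 2 + 2 * x * ip c (w ord0) + x ^+ 2 * `|w ord0| ^+ 2 + 8 * h * s).
  rewrite /F -!ip_norm (sipD ipP) (sipZl ipP) !(sipZr ipP).
  by congr (_ * _); ring.
rewrite (@integral_symmetrize _ F G).
- apply: (le_trans (integral_gauss1_affine _ _ _)) => //.
  + by rewrite !mulr_ge0// addr_ge0 ?sqr_ge0// !mulr_ge0// ltW.
  + by rewrite mulr_ge0 ?sqr_ge0.
  by rewrite lee_fin big_ord_recl -/s le_eqVlt; apply/orP; left; apply/eqP; ring.
- rewrite (_ : F = fun x => k * gauss1 h x *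
    (`|c| ^+ 2 + 2 * x * ip c (w ord0) + x ^+ 2 * `|w ord0| ^+ 2 + 8 * h * s)).
    apply: measurable_funM.
      by apply: measurable_funM => //; exact: measurable_gauss1.
    apply: measurable_funD => //; apply: measurable_funD.
      by apply: measurable_funD => //; apply: measurable_funM => //; exact: measurable_funM.
    by apply: measurable_funM.
  exact/funext.
- by move=> x; rewrite /F !mulr_ge0 ?gauss1_ge0// addr_ge0 ?sqr_ge0// !mulr_ge0// ltW.
- by move=> x; rewrite !FE gauss1N// /G; ring.
Qed.

End GaussianQuadratic.

(** * Measurability of the norm *)

Section MeasurableEmbeddingNorm.
Context {R : realType} {H : completeNormedModType R} {ip : {dot H for idfun}}.
Hypothesis ip_norm : forall x, ip x x = `|x| ^+ 2.
Context {A T : H -> H} {e : nat -> H} {i : {linear H -> H}}.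
Hypothesis iW : wiener_embedding ip A e T i.
Context {z : nat -> H} (iz : forall k, i (z k) = e k).

Let ipP := ip_sip ip_norm.
Let e_on : orthonormal_for ip e. Proof. by case: (we_basis iW). Qed.

Lemma basis_projection N : exists2 P : {linear H -> H},
  finite_rank_projection ip P & forall k, (k < N)%N -> P (e k) = e k.
Proof.
pose p x := \sum_(k < N) ip x (e k) *: e k.
have p_lin (a : R) x y : p (a *: x + y) = a *: p x + p y.
  rewrite /p scaler_sumr -big_split/=; apply: eq_bigr => k _.
  by rewrite (sipPl ipP) scalerDl scalerA.
have p_e k : (k < N)%N -> p (e k) = e k.
  move=> kN; rewrite /p (bigD1 (Ordinal kN))//= e_on eqxx scale1r.
  rewrite big1 ?addr0// => j jk; rewrite e_on eq_sym.
  by have /negbTE -> : (j : nat) != k; rewrite ?scale0r.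
have [P PE] := linear_bundle p_lin.
have {}PE x : P x = p x by rewrite PE.
exists P => [|k kN]; last by rewrite PE p_e.
split=> [x|x y|].
- rewrite (PE x) {1}/p linear_sum [RHS]/p; apply: eq_bigr => k _.
  by rewrite linearZ PE p_e.
- rewrite !PE (sip_suml ipP) (sip_sumr ipP); apply: eq_bigr => k _.
  by rewrite (sipZl ipP) (sipZr ipP) (sipC ipP (e k)) mulrC.
exists N, (fun k : 'I_N => e k) => _ [x _ <-].
by rewrite PE; exists (fun k : 'I_N => ip x (e k)).
Qed.

(** Since each [w j] is orthogonal to the span of the first [N] basis vectors, [a] may be replaced
    by its residual, to which Bessel applies. *)
Lemma sum_sqr_orthogonal_le N n (w : 'I_n -> H) a : orthonormal_for ip w ->
  (forall j (k : 'I_N), ip (w j) (e k) = 0) ->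
  \sum_(j < n) ip (w j) a ^+ 2 <= defect (ip := ip) (fun k : 'I_N => e k) a.
Proof.
move=> won we; have eon : orthonormal_for ip (fun k : 'I_N => e k).
  exact: orthonormal_ord.
rewrite (defectE ip_norm _ eon) -ip_norm.
apply: le_trans (sip_bessel ipP won _); rewrite le_eqVlt; apply/orP; left.
apply/eqP; apply: eq_bigr => j _; rewrite (sipBl ipP) (sip_suml ipP) big1 ?subr0.
  by rewrite (sipC ipP).
by move=> k _; rewrite (sipZl ipP) (sipC ipP (e k)) we mulr0.
Qed.

Lemma measurable_embedding_norm : measurable_norm ip (fun x => `|i x|).
Proof.
split.
  split=> [x /normr0_eq0|a x|x y]; first exact: we_injective iW x.
    by rewrite linearZ normrZ.
  by rewrite linearD ler_normD.
(* Chosen so that the Chebyshev bound [8 * eps / eta ^+ 2] equals [eta / 2]. *)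
move=> eta eta0; pose eps := eta ^+ 3 / 16.
have eps0 : 0 < eps by rewrite divr_gt0// exprn_gt0.
have [N _ /(_ N (leqnn N)) Neps] := sum_defect_cvg ip_norm
  (orthonormal_basis_span (we_basis iW)) (@lspan_incr _ _ e)
  (we_basis iW).2 (hilbert_schmidt_adjoint ip_norm iW iz) eps0.
have [P0 P0P P0e] := basis_projection N; exists P0 => // P _ PP0 n w [won Pw].
have we j (k : 'I_N) : ip (w j) (e k) = 0.
  have [x _ <-] : range P (w j) by rewrite Pw; exact: mem_lspan.
  by rewrite -(P0e k)// PP0.
have iw : \sum_(j < n) `|i (w j)| ^+ 2 <= eps.
  apply: (sum_norm_embedding_le ip_norm iW iz) => K.
  apply: le_trans (Neps K); apply: ler_sum => k _.
  exact: sum_sqr_orthogonal_le.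
(* Chebyshev: the indicator of [eta < |y|] is at most [k * |y|^2]. *)
pose k := (eta ^+ 2)^-1; have k0 : 0 < k by rewrite invr_gt0 exprn_gt0.
apply: (@le_lt_trans _ _ (k * (`|0 : H| ^+ 2 + 8 * 1 * \sum_(j < n) `|i (w j)| ^+ 2))%:E).
  apply: le_trans (integral_gaussian_sqr_norm ip_norm 0 (fun j => i (w j)) ltr01 (ltW k0)).
  apply: le_integral_Rn => v; first by rewrite lee_fin mulr_ge0 ?gaussian_density_ge0.
  rewrite lee_fin add0r mulrCA ler_wpM2l ?gaussian_density_ge0//.
  rewrite indicE; case: (boolP (v \in _)) => [/set_mem/= ltN|_]; last first.
    by rewrite mulr_ge0 ?sqr_ge0// ltW.
  rewrite ler_pdivlMl ?exprn_gt0// mulr1 -ler_sqrt ?sqr_ge0//.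
  have -> : \sum_(j < n) tnth v j *: i (w j) = i (\sum_(j < n) tnth v j *: w j).
    by rewrite linear_sum; apply: eq_bigr => j _; rewrite linearZ.
  by rewrite !sqrtr_sqr normr_id gtr0_norm// ltW.
rewrite lte_fin normr0 expr0n add0r mulr1.
apply: (@le_lt_trans _ _ (k * (8 * eps))); first by rewrite !ler_wpM2l// ltW.
have -> : k * (8 * eps) = eta / 2 by rewrite /k /eps; field; rewrite gt_eqF.
by rewrite ltr_pdivrMr// ltr_pMr// ltr1n.
Qed.

End MeasurableEmbeddingNorm.

(** * Lipschitz symbols and their extension *)

Section SymbolLipschitz.
Context {R : realType} {H : completeNormedModType R}.

Lemma bounded_multilinear1Z (L : 1.-tuple H -> R) (a : R) v : bounded_multilinear L ->
  L [tuple a *: v] = a * L [tuple v].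
Proof.
move=> [Llin _]; have up u : tuple_update [tuple v] ord0 u = [tuple u].
  by apply: eq_from_tnth => k; rewrite tnth_mktuple !ord1 eqxx.
have L0 : L [tuple 0] = 0.
  have := Llin [tuple v] ord0 1 0 0; rewrite !up scaler0 addr0 mul1r.
  by rewrite -{1}[L _]addr0 => /addrI.
by have := Llin [tuple v] ord0 a v 0; rewrite !up !addr0 L0 addr0.
Qed.

Lemma frechet_is_derive (f : H -> R) D y u (t : R) : frechet_derivatives f D ->
  is_derive t 1 (fun s : R => f (y + s *: u)) (D 1%N (y + t *: u) [tuple u]).
Proof.
move=> [D0 Dmul Dder]; set l := D 1%N _ _; set g := fun s : R => _.
have D0E x (U : 0.-tuple H) : D 0%N x U = f x by rewrite tuple0 D0.
have gl : (fun h => h^-1 *: ((g \o shift t) (h *: (1 : R)) - g t)) @ 0^' --> l.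
  apply/cvgrPdist_le => eps eps0.
  (* [|u| + 1] stays a legitimate divisor when [u = 0]. *)
  have u1 : 0 < `|u| + 1 by rewrite ltr_pwDr.
  have /nbhs_norm0P[r /= r0 near_r] := Dder 0%N (y + t *: u) _ (divr_gt0 eps0 u1).
  near=> h.
  have h0 : h != 0 by near: h; exact: nbhs_dnbhs_neq.
  have hp : 0 < `|h| by rewrite normr_gt0.
  have hr : `|h *: u| < r.
    apply: (@le_lt_trans _ _ (`|h| * (`|u| + 1))).
      by rewrite normrZ ler_wpM2l// lerDl.
    rewrite -ltr_pdivlMr//; near: h; apply: dnbhs0_lt; exact: divr_gt0.
  have := near_r _ hr [tuple]; rewrite !D0E big_ord0 mulr1.
  rewrite bounded_multilinear1Z -/l; last exact: Dmul.
  have -> : y + t *: u + h *: u = y + (h + t) *: u by rewrite scalerDl addrAC addrA.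
  rewrite /= -/(g (h + t)) -/(g t) => gh.
  rewrite -(ler_pM2l hp) -normrM mulrBr.
  rewrite [X in _ - X](_ : _ = g (h + t) - g t); last first.
    by rewrite /GRing.scale/= mulr1 mulVKf.
  rewrite distrC; apply: (le_trans gh).
  rewrite normrZ mulrCA ler_wpM2l// mulrAC ler_pdivrMr//.
  by rewrite ler_wpM2l ?lerDl// ltW.
apply: DeriveDef; first by apply/cvg_ex; exists l.
exact: cvg_lim gl.
Unshelve. all: by end_near. Qed.

(** Mean value theorem along the segment from [y] to [x], with the bound on the first differential
    in the direction [x - y]. *)
Lemma S_class_lipschitz (Q : H -> R) (f : H -> R) : S_class Q f ->
  exists2 C : R, 0 < C & (forall x, `|f x| <= C) /\
    forall x y, `|f x - f y| <= C * Num.sqrt (Q (x - y)).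
Proof.
move=> [D fD [C C0 [fC DC]]]; exists C => //; split=> // x y.
pose g (t : R) := f (y + t *: (x - y)).
pose dg t := D 1%N (y + t *: (x - y)) [tuple x - y].
have g' (t : R) : is_derive t (1 : R) g (dg t) by exact: frechet_is_derive.
have gc : continuous g.
  by move=> t; apply/differentiable_continuous/derivable1_diffP; case: (g' t).
have [c _] := MVT ltr01 (fun t _ => g' t) (continuous_subspaceT gc).
rewrite subr0 mulr1 /g scale1r scale0r addr0 subrKC => ->.
by apply: (le_trans (DC _ _ _ _)) => //; rewrite big_ord1.
Qed.

End SymbolLipschitz.

(* McShane's formula [F b = inf_x f x + C * `|b - i x|]. *)
Section McShane.
Context {R : realType} {V W : normedModType R} {i : V -> W} {f : V -> R} {C M : R}.
Hypothesis C_ge0 : 0 <= C.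
Hypothesis f_bounded : forall x, `|f x| <= M.
Hypothesis f_lip : forall x y, `|f x - f y| <= C * `|i x - i y|.

Let graph b := range (fun x => f x + C * `|b - i x|).

Let graph_lb b : has_lbound (graph b).
Proof.
exists (- M) => _ [x _ <-]; rewrite -[leLHS]addr0 lerD ?mulr_ge0//.
by have := f_bounded x; rewrite ler_norml => /andP[].
Qed.

Lemma lipschitz_extension : exists F : W -> R,
  (forall x, F (i x) = f x) /\ forall b c, `|F b - F c| <= C * `|b - c|.
Proof.
exists (fun b => inf (graph b)).
have F_lip b c : inf (graph b) <= inf (graph c) + C * `|b - c|.
  rewrite -lerBlDr; apply: lb_le_inf; first by eexists; exists 0.
  move=> _ [x _ <-]; rewrite lerBlDr.
  apply: (@le_trans _ _ (f x + C * `|b - i x|)).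
    by apply: ge_inf => //; exists x.
  rewrite -addrA lerD2l -mulrDr ler_wpM2l// [leRHS]addrC.
  by rewrite -[b - i x](subrKA c) ler_normD.
split=> [x|b c].
  apply/eqP; rewrite eq_le; apply/andP; split.
    by apply: ge_inf => //; exists x; rewrite ?subrr ?normr0 ?mulr0 ?addr0.
  apply: lb_le_inf; first by eexists; exists 0.
  move=> _ [y _ <-]; rewrite -lerBlDl.
  exact: le_trans (ler_norm _) (f_lip _ _).
rewrite ler_norml; have := F_lip b c; have := F_lip c b.
by rewrite (distrC c b) => h1 h2; apply/andP; split; lra.
Qed.

End McShane.

Lemma lipschitz_unif_continuous {R : realType} {W : normedModType R} (F : W -> R)
    (C : R) : 0 < C -> (forall b c, `|F b - F c| <= C * `|b - c|) ->
  unif_continuous F.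
Proof.
move=> C0 FC; apply/unif_continuousP => eps eps0; exists (eps / C).
  exact: divr_gt0.
move=> [b c]/=; rewrite -!ball_normE/= ltr_pdivlMr// => bc.
by apply: (le_lt_trans (FC b c)); rewrite mulrC.
Qed.

Lemma lipschitz_continuous {R : realType} {W : normedModType R} (F : W -> R)
    (C : R) : 0 < C -> (forall b c, `|F b - F c| <= C * `|b - c|) ->
  continuous F.
Proof.
move=> C0 FC b; apply/cvgrPdist_lt => eps eps0; near=> c.
apply: (le_lt_trans (FC b c)); rewrite mulrC -ltr_pdivlMr//.
by near: c; apply: cvgr_dist_lt => //; exact: divr_gt0.
Unshelve. all: by end_near. Qed.

(** * Integral norms and measurability *)

Section LnormBounds.
Context {d : measure_display} {T : measurableType d} {R : realType}.
Context {mu : {measure set T -> \bar R}}.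
Local Open Scope ereal_scope.

Lemma Lnorm_leP (g : T -> R) (p M : R) : (0 < p)%R -> (0 <= M)%R ->
  'N[mu]_p%:E[EFin \o g] <= M%:E <->
  \int[mu]_x (`|g x| `^ p)%:E <= (M `^ p)%:E.
Proof.
move=> p0 M0.
have iE : \int[mu]_x (`|g x| `^ p)%:E = \int[mu]_x (`|(EFin \o g) x| `^ p).
  exact: eq_integral.
have i0 : 0 <= \int[mu]_x (`|g x| `^ p)%:E.
  by apply: integral_ge0 => x _; rewrite lee_fin powR_ge0.
split=> [gM|gM].
  rewrite iE -poweR_Lnorm ?gt_eqF// -poweR_EFin.
  apply: gt0_ler_poweR => //; first exact: ltW.
    by rewrite in_itv/= leey Lnorm_ge0.
  by rewrite in_itv/= leey lee_fin M0.
have -> : M = ((M `^ p) `^ p^-1)%R by rewrite -powRrM divff ?gt_eqF// powRr1.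
rewrite unlock -iE -poweR_EFin; apply: gt0_ler_poweR => //.
- by rewrite invr_ge0 ltW.
- by rewrite in_itv/= leey i0.
- by rewrite in_itv/= leey lee_fin powR_ge0.
Qed.

Lemma L2_leP (g : T -> R) (M : R) : (0 <= M)%R ->
  'N[mu]_2%:E[EFin \o g] <= M%:E <-> \int[mu]_x (g x ^+ 2)%:E <= (M ^+ 2)%:E.
Proof.
move=> M0; rewrite (Lnorm_leP _ (ltr0n R 2))// powR_mulrn//.
rewrite [X in X <= _](_ : _ = \int[mu]_x (g x ^+ 2)%:E)//.
by apply: eq_integral => x _; rewrite powR_mulrn// real_normK ?num_real.
Qed.

Lemma measurable_Lfun (g : T -> R) (p : R) : measurable_fun [set: T] g ->
  'N[mu]_p%:E[EFin \o g] < +oo -> g \in Lfun mu p%:E.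
Proof. by move=> mg gp; apply/andP; split; rewrite inE. Qed.

Lemma Lfun_measurable (g : T -> R) (p : R) : g \in Lfun mu p%:E ->
  measurable_fun [set: T] g.
Proof. by move=> /andP[+ _]; rewrite inE. Qed.

Lemma LnormZ_le (g : T -> R) (p a M : R) : (1 <= p)%R ->
  measurable_fun [set: T] g -> 'N[mu]_p%:E[EFin \o g] <= M%:E ->
  'N[mu]_p%:E[EFin \o (a \*: g)%R] <= (`|a| * M)%:E.
Proof.
move=> p1 mg gM; have p1E : 1 <= p%:E by rewrite lee_fin.
have gL : g \in Lfun mu p%:E.
  by apply: measurable_Lfun mg _; rewrite (le_lt_trans gM)// ltry.
by rewrite (LnormZ (Lfun_Sub p1E gL) a) EFinM lee_wpmul2l ?lee_fin.
Qed.

Lemma eq_ae_Lnorm (f g : T -> R) (p : R) :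
  measurable_fun [set: T] f -> measurable_fun [set: T] g ->
  {ae mu, forall x, f x = g x} ->
  'N[mu]_p%:E[EFin \o f] = 'N[mu]_p%:E[EFin \o g].
Proof.
move=> mf mg fg; rewrite unlock; congr (_ `^ _); apply: ae_eq_integral => //.
- apply: (@measurableT_comp _ _ _ _ _ _ (fun x : \bar R => x `^ p)) => //.
    exact: measurable_poweR.
  by apply: measurableT_comp => //; exact/measurable_EFinP.
- apply: (@measurableT_comp _ _ _ _ _ _ (fun x : \bar R => x `^ p)) => //.
    exact: measurable_poweR.
  by apply: measurableT_comp => //; exact/measurable_EFinP.
- by apply: filterS fg => x /= ->.
Qed.

End LnormBounds.

Section BoundedLfun.
Context {d : measure_display} {T : measurableType d} {R : realType}.
Context {P : probability T R}.
Local Open Scope ereal_scope.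

Lemma bounded_Lfun (g : T -> R) (p K : R) : (1 <= p)%R ->
  measurable_fun [set: T] g -> (forall x, (`|g x| <= K)%R) -> g \in Lfun P p%:E.
Proof.
move=> p1 mg gK; apply: measurable_Lfun => //.
have p0 : (0 < p)%R by exact: lt_le_trans p1.
have K0 : (0 <= K)%R by exact: le_trans (gK point).
apply: (@le_lt_trans _ _ K%:E); last exact: ltry.
apply/Lnorm_leP => //.
apply: (@le_trans _ _ (\int[P]_x cst (K `^ p)%:E x)).
  apply: le_integral_ge0 => x; first by rewrite lee_fin powR_ge0.
  by rewrite lee_fin; apply: ge0_ler_powR; rewrite ?nnegrE// ltW.
rewrite integral_cst//; set m := (X in _ * X).
by have -> : m = 1; [exact: probability_setT|rewrite mule1].
Qed.

(* [t `^ p <= delta `^ p] when [t <= delta], and [1 <= (t / delta) ^+ 2]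
   otherwise. *)
Lemma powR_le_delta (t delta K p : R) : (0 < delta)%R -> (0 <= t <= K)%R ->
  (1 <= p)%R ->
  (t `^ p <= delta `^ p + K `^ p / delta ^+ 2 * t ^+ 2)%R.
Proof.
move=> delta0 /andP[t0 tK] p1; have p0 : (0 <= p)%R by exact: le_trans p1.
have Kp : (t `^ p <= K `^ p)%R.
  by apply: ge0_ler_powR; rewrite ?nnegrE// (le_trans t0).
have [td|dt] := leP t delta.
  rewrite -[leLHS]addr0 lerD//.
    by apply: ge0_ler_powR; rewrite ?nnegrE// ltW.
  by rewrite mulr_ge0 ?sqr_ge0// divr_ge0 ?powR_ge0 ?sqr_ge0.
rewrite -[leLHS]add0r lerD ?powR_ge0//; apply: (le_trans Kp).
rewrite mulrAC ler_pdivlMr ?exprn_gt0// ler_wpM2l ?powR_ge0//.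
by rewrite ler_pXn2r ?nnegrE ?(ltW delta0)// ltW.
Qed.

End BoundedLfun.

Section BorelMeasurability.
Context {R : realType} {B : completeNormedModType R}.

Lemma continuous_borel_measurable (g : B -> R) : continuous g ->
  measurable_fun [set: borel_space B] (g : borel_space B -> R).
Proof.
move=> /continuousP cg; apply: (measurability _ (RGenOpens.measurableE R)).
move=> _ [_ [a [b ->]] <-]; rewrite setTI; apply: sub_sigma_algebra.
by apply: cg; exact: interval_open.
Qed.

End BorelMeasurability.

(* [{phi X < a}] is the union over rational vectors [q] of the measurable sets
   [{phi q + L * sum_j `|X j - q j| < a}]. *)
Lemma measurable_lipschitz_comp {d : measure_display} {T : measurableType d}
    {R : realType} (n : nat) (X : 'I_n -> T -> R) (phi : ('I_n -> R) -> R) (L : R) :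
  0 <= L -> (forall j, measurable_fun [set: T] (X j)) ->
  (forall c c', `|phi c - phi c'| <= L * \sum_(j < n) `|c j - c' j|) ->
  measurable_fun [set: T] (fun x => phi (X ^~ x)).
Proof.
move=> L0 mX phiL; apply: (measurability _ (RGenInftyO.measurableE R)).
move=> _ [_ [a ->] <-]; rewrite setTI.
pose q (r : {ffun 'I_n -> rat}) := fun j => ratr (r j) : R.
pose Z r x := phi (q r) + L * \sum_(j < n) `|X j x - q r j|.
rewrite (_ : _ @^-1` _ = \bigcup_(r in [set: {ffun 'I_n -> rat}]) [set x | Z r x < a]).
  apply: countable_bigcupT_measurable => // r.
  rewrite -[X in measurable X]setTI.
  have mZ : measurable_fun [set: T] (Z r).
    apply: measurable_funD => //; apply: measurable_funM => //.
    apply: measurable_sum => j; apply: measurableT_comp => //.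
    exact: measurable_funB.
  have := mZ measurableT `]-oo, a[%classic (measurable_itv _).
  by congr (measurable (_ `&` _)); apply/seteqP; split=> x /=; rewrite in_itv.
apply/seteqP; split=> x /=; rewrite in_itv/=; last first.
  move=> [r _]; apply: le_lt_trans; rewrite -lerBlDl.
  exact: le_trans (ler_norm _) (phiL _ _).
(* The factor 2 pays for both [L * S] in [Z] and the error of [phi] at the rational point; [L + 1]
   and [n.+1] keep the divisor positive. *)
move=> xa; pose eps := (a - phi (X ^~ x)) / (2 * (L + 1) * n.+1%:R).
have L1 : 0 < L + 1 by rewrite ltr_pwDr.
have eps0 : 0 < eps by rewrite divr_gt0 ?subr_gt0// !mulr_gt0.
have /choice[r rP] : forall j : 'I_n, exists s : rat, `|X j x - ratr s| < eps.
  move=> j; have [|s] := @rat_in_itvoo R (X j x - eps) (X j x + eps).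
    by rewrite ltrD2l gtrN.
  rewrite in_itv/= => /andP[s1 s2]; exists s.
  by rewrite ltr_norml; apply/andP; split; lra.
exists [ffun j => r j] => //=; rewrite /Z.
set S := \sum_(j < n) _; have S0 : 0 <= S by exact: sumr_ge0.
have SE : S <= n%:R * eps.
  rewrite mulr_natl -[X in _ *+ X]card_ord -sumr_const; apply: ler_sum => j _.
  by rewrite /q ffunE ltW.
have LS : 2 * (L * S) < a - phi (X ^~ x).
  apply: (@le_lt_trans _ _ (2 * ((L + 1) * (n%:R * eps)))).
    rewrite ler_wpM2l// ler_pM//; lra.
  have -> : 2 * ((L + 1) * (n%:R * eps)) = (a - phi (X ^~ x)) * (n%:R / n.+1%:R).
    by rewrite /eps; field; rewrite !gt_eqF.
  rewrite gtr_pMr ?subr_gt0// ltr_pdivrMr// mul1r ltr_nat//.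
have := phiL (X ^~ x) (q [ffun j => r j]); rewrite -/S ler_norml => /andP[+ _].
by move=> ?; lra.
Qed.

(** * Gaussian measures on the completion *)

Lemma scalar_bundle {R : realType} {U : lmodType R} (f : U -> R) :
  (forall (a : R) x y, f (a *: x + y) = a * f x + f y) ->
  exists F : {scalar U}, (F : U -> R) = f.
Proof.
move=> fP; pose m := GRing.isLinear.Build R U R *%R f fP.
by exists (HB.pack_for {scalar U} f m).
Qed.

(** The Radon-Nikodym derivative and [normal_pdf] have the same integral over every measurable set,
    so they agree almost everywhere. *)
Lemma ge0_integral_normal_prob {R : realType} (m s : R) (f : R -> \bar R) :
  s != 0 -> measurable_fun [set: R] f -> (forall x, (0 <= f x)%E) ->
  (\int[normal_prob m s]_x f x =
   \int[lebesgue_measure]_x (f x * (normal_pdf m s x)%:E))%E.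
Proof.
move=> s0 mf f0; have dom := normal_prob_dominates m s.
rewrite -(Radon_Nikodym_SigmaFinite.change_of_variables dom)//.
have mRN : measurable_fun [set: R]
    (Radon_Nikodym_SigmaFinite.f (normal_prob m s) lebesgue_measure).
  exact: measurable_int (Radon_Nikodym_SigmaFinite.f_integrable dom).
have mpdf : measurable_fun [set: R] (fun x => (normal_pdf m s x)%:E).
  by apply/measurable_EFinP; exact: measurable_normal_pdf.
apply: ae_eq_integral => //.
- exact: emeasurable_funM.
- exact: emeasurable_funM.
apply: ae_eqe_mul2l; apply: integral_ae_eq => //.
- exact: Radon_Nikodym_SigmaFinite.f_integrable.
- by move=> E _ mE; rewrite -Radon_Nikodym_SigmaFinite.f_integral.
Qed.

Section GaussianMeasure.
Context {R : realType} {H : completeNormedModType R} {ip : {dot H for idfun}}.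
Hypothesis ip_norm : forall x, ip x x = `|x| ^+ 2.
Context {A T : H -> H} {e : nat -> H} {i : {linear H -> H}}.
Hypothesis iW : wiener_embedding ip A e T i.
Context {h : R} {mu : probability (borel_space H) R} {ell : H -> borel_space H -> R}.
Hypothesis h_gt0 : 0 < h.
Hypothesis mu_gauss : is_gaussian_measure ip i h mu.
Hypothesis ellP : is_ell ip i mu ell.

Let ipP := ip_sip ip_norm.

(** Linearity of [T] is forced by the adjoint relation and the nondegeneracy of [ip]. *)
Lemma adjointP (a : R) x y : T (a *: x + y) = a *: T x + T y.
Proof.
apply/eqP; rewrite -subr_eq0; apply/eqP/(ip_eq0 ip_norm) => v.
rewrite (sipC ipP) (sipBr ipP) (sipDr ipP) (sipZr ipP) -!(we_adjoint iW).
by rewrite linearP (sipDr ipP) (sipZr ipP) subrr.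
Qed.

(** The functional [<., i z>] on the completion restricts to [<T z, .>] on [H]. As [T] has dense
    range, this supplies an explicit dense part of the dual inside [H]. *)
Lemma dual_vector_embedding z : exists2 y : {scalar H},
  (y : H -> R) = (fun x => ip x (i z)) & dual_vector ip i y (T z).
Proof.
have [|y yE] := @scalar_bundle R H (fun x => ip x (i z)).
  by move=> a u v; rewrite (sipPl ipP).
exists y => //; split.
  by rewrite yE; exact: ip_continuous.
by move=> x; rewrite yE (we_adjoint iW) (sipC ipP).
Qed.

Lemma measurable_dual v : measurable_fun [set: borel_space H] (fun x : borel_space H => ip x v).
Proof. by apply: continuous_borel_measurable; exact: ip_continuous. Qed.

Lemma gaussian_marginal z (S : set R) : `|T z| = 1 -> measurable S ->
  mu [set x | S (ip x (i z))] = normal_prob 0 (Num.sqrt h) S.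
Proof.
move=> Tz1 mS; have [y yE yT] := dual_vector_embedding z.
have on : orthonormal_family ip (fun _ : 'I_1 => T z).
  by move=> j k; rewrite ip_norm Tz1 expr1n !ord1 eqxx.
pose S1 := [set v : 1.-tuple R | S (tnth v ord0)].
have mS1 : measurable S1.
  by have := measurable_tnth (@ord0 0) measurableT mS; rewrite setTI.
have := mu_gauss (fun=> yT) on mS1.
rewrite (_ : [set x | S1 _] = [set x | S (ip x (i z))]); last first.
  by apply/seteqP; split=> x; rewrite /S1/= tnth_mktuple yE.
move=> ->; rewrite /gaussian_Rn /normal_prob [RHS]integral_mkcond/=.
apply: eq_integral => x _; rewrite gaussian_density_cons// gaussian_density0 mulr1.
rewrite patchE indicE.
have -> : ([tuple of x :: [tuple]] \in S1) = (x \in S).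
  by apply/idP/idP; rewrite !inE.
by case: ifP => _; rewrite ?mulr1 ?mulr0.
Qed.

(** Rescaling [z] to make [T z] a unit vector reduces to the one-dimensional marginal. If [T z = 0],
    then [|i z|^2 = <z, T z>] vanishes too. *)
Lemma second_moment z :
  (\int[mu]_x (ip x (i z) ^+ 2)%:E <= (8 * h * `|T z| ^+ 2)%:E)%E.
Proof.
have [Tz0|Tz0] := eqVneq (T z) 0.
  have iz0 : i z = 0.
    by apply/eqP; rewrite -normr_eq0 -sqrf_eq0 -ip_norm (we_adjoint iW) Tz0 (sip0r ipP).
  rewrite Tz0 normr0 expr0n mulr0 integral0_eq// => x _.
  by rewrite iz0 (sip0r ipP) expr0n.
pose r := `|T z|; have r0 : 0 < r by rewrite normr_gt0.
pose z1 := r^-1 *: z.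
have T0 : T 0 = 0.
  by have /esym := adjointP 1 0 0; rewrite !scale1r addr0 -[RHS]addr0 => /addrI.
have Tz1 : `|T z1| = 1.
  rewrite /z1 -[_ *: z]addr0 adjointP T0 addr0 normrZ gtr0_norm ?invr_gt0//.
  by rewrite mulVf// gt_eqF.
pose Y (x : borel_space H) : measurableTypeR R := ip x (i z1).
have mY : measurable_fun [set: borel_space H] Y by exact: measurable_dual.
have msqr : measurable_fun [set: R] (fun t : R => (t ^+ 2)%:E).
  exact/measurable_EFinP.
have Y2 : (\int[mu]_x (Y x ^+ 2)%:E <= (8 * h)%:E)%E.
  have -> : (\int[mu]_x (Y x ^+ 2)%:E =
      \int[pushforward mu Y]_t (t ^+ 2)%:E)%E.
    rewrite ge0_integral_pushforward//.
    by move=> t _; rewrite lee_fin sqr_ge0.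
  have -> : (\int[pushforward mu Y]_t (t ^+ 2)%:E =
      \int[normal_prob 0%R (Num.sqrt h)]_t (t ^+ 2)%:E)%E.
    apply: eq_measure_integral => S mS _; exact: gaussian_marginal.
  rewrite ge0_integral_normal_prob//.
  - apply: le_trans (integral_gauss1_sqr h_gt0).
    apply: le_integral_ge0 => t; rewrite -EFinM lee_fin//.
    by rewrite mulr_ge0 ?sqr_ge0// normal_pdf_ge0.
  - by rewrite gt_eqF// sqrtr_gt0.
  - by move=> t; rewrite lee_fin sqr_ge0.
have zE x : ip x (i z) ^+ 2 = r ^+ 2 * Y x ^+ 2.
  rewrite /Y /z1 linearZ (sipZr ipP) exprMn mulrA -exprMn divff ?gt_eqF//.
  by rewrite expr1n mul1r.
under eq_integral do rewrite zE EFinM.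
rewrite ge0_integralZl//.
- by rewrite [leRHS]EFinM muleC lee_pmul2r// lte_fin exprn_gt0.
- by apply/measurable_EFinP; apply: measurable_funX.
- by move=> x _; rewrite lee_fin sqr_ge0.
- by rewrite lee_fin sqr_ge0.
Qed.

Lemma L2_norm_dual z :
  ('N[mu]_2%:E[EFin \o (fun x : borel_space H => ip x (i z))] <=
   (Num.sqrt (8 * h) * `|T z|)%:E)%E.
Proof.
apply/L2_leP; first by rewrite mulr_ge0 ?sqrtr_ge0.
by rewrite exprMn sqr_sqrtr ?mulr_ge0 ?(ltW h_gt0)// second_moment.
Qed.

Lemma measurable_ell a : measurable_fun [set: borel_space H] (ell a).
Proof. by case: ellP => ell2 _ _; exact: Lfun_measurable (ell2 a). Qed.

(** Continuity of [a |-> ell a] combined with the density of the range of [T], on which [ell] is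
    almost everywhere an explicit functional. *)
Lemma ell_approx a (eps : R) : 0 < eps -> exists2 z, `|a - T z| < eps &
  ('N[mu]_2%:E[EFin \o (ell a \- (fun x : borel_space H => ip x (i z)))%R] <= eps%:E)%E.
Proof.
move=> eps0; case: ellP => _ ell_dual ell_cont.
have near_a : \forall b \near a,
    ('N[mu]_2%:E[EFin \o (ell b \- ell a)%R] < eps%:E)%E.
  apply: (ell_cont a [set x | (x < eps%:E)%E]).
  apply: open_nbhs_nbhs; split; first exact: open_ereal_lt_ereal.
  by rewrite /= lte_fin.
have /nbhs_normP[r /= r0 ra] := near_a.
have er0 : 0 < Num.min eps r by rewrite lt_min eps0.
have [z az] := we_dense_adjoint iW a er0.
move: az; rewrite lt_min => /andP[aeps ar].
have [y yE yT] := dual_vector_embedding z.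
exists z => //; apply/ltW; apply: le_lt_trans (ra _ ar).
rewrite -[X in (_ <= X)%E]oppe_Lnorm.
rewrite [X in (_ <= 'N[_]_ _[X])%E](_ : _ = EFin \o (ell a \- ell (T z))%R); last first.
  by apply/funext => x /=; rewrite opprB.
rewrite le_eqVlt; apply/orP; left; apply/eqP; apply: eq_ae_Lnorm.
- by apply: measurable_funB; [exact: measurable_ell|exact: measurable_dual].
- by apply: measurable_funB; exact: measurable_ell.
- by apply: filterS (ell_dual _ _ yT) => x /= ->; rewrite yE.
Qed.

(** Extends [L2_norm_dual] to combinations of the [ell (w j)]. The last term is replaced by
    [<., i v>] with [T v] close to the last vector, and this functional is absorbed into [z] before
    the induction hypothesis is applied. *)
Lemma L2_norm_ell_sum n (c : 'I_n -> R) (w : 'I_n -> H) z :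
  ('N[mu]_2%:E[EFin \o (fun x => \sum_(j < n) c j * ell (w j) x - ip x (i z))%R] <=
   (Num.sqrt (8 * h) * `|\sum_(j < n) c j *: w j - T z|)%:E)%E.
Proof.
elim: n c w z => [|n IHn] c w z.
  rewrite big_ord0 sub0r normrN; apply: le_trans (L2_norm_dual z).
  rewrite -[X in (_ <= X)%E]oppe_Lnorm le_eqVlt; apply/orP; left; apply/eqP.
  by apply: eq_Lnorm => x /=; rewrite big_ord0 sub0r EFinN.
apply/lee_addgt0Pr => eps eps0.
pose s := Num.sqrt (8 * h); have s0 : 0 <= s by exact: sqrtr_ge0.
(* The approximation is paid for twice, in [L^2] and, with the factor [s], in [H]; this [k] keeps
   the total below [eps]. *)
pose k := `|c ord_max| * (s + 1) + 1.
have k0 : 0 < k by rewrite ltr_wpDl// mulr_ge0// addr_ge0.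
have [v wv Nv] := @ell_approx (w ord_max) _ (divr_gt0 eps0 k0).
pose c' j := c (widen_ord (leqnSn n) j).
pose w' j := w (widen_ord (leqnSn n) j).
pose z' := z - c ord_max *: v.
have Tz' : T z' = T z - c ord_max *: T v.
  by rewrite /z' addrC -scaleNr adjointP scaleNr addrC.
pose F x := \sum_(j < n) c' j * ell (w' j) x - ip x (i z').
pose G x := ell (w ord_max) x - ip x (i v).
have mF : measurable_fun [set: borel_space H] F.
  apply: measurable_funB; last exact: measurable_dual.
  by apply: measurable_sum => j; apply: measurable_funM => //; exact: measurable_ell.
have mG : measurable_fun [set: borel_space H] G.
  by apply: measurable_funB; [exact: measurable_ell|exact: measurable_dual].
rewrite (_ : (fun x => _) = F \+ (c ord_max \*: G)); last first.
  apply/funext => x; rewrite big_ord_recr /F /G/= /z' raddfB/= linearZ.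
  by rewrite (sipBr ipP) (sipZr ipP) /GRing.scale/=; ring.
apply: (le_trans (minkowski_EFin _ mF _ _)).
- exact: measurable_funM.
- by rewrite ler1n.
apply: (@le_trans _ _ (s * `|\sum_(j < n) c' j *: w' j - T z'| +
    `|c ord_max| * (eps / k))%:E).
  rewrite [leRHS]EFinD; apply: leeD; first exact: IHn.
  by apply: LnormZ_le => //; rewrite ler1n.
rewrite -EFinD lee_fin big_ord_recr/= -/s.
set X := \sum_(j < n) _.
have -> : X - T z' = X + c ord_max *: w ord_max - T z + c ord_max *: (T v - w ord_max).
  rewrite Tz' scalerBr opprB addrCA [X + c ord_max *: _]addrC.
  by rewrite -[X in _ = X + _]addrA [RHS]addrC subrKA.
have : `|X + c ord_max *: w ord_max - T z + c ord_max *: (T v - w ord_max)| <=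
    `|X + c ord_max *: w ord_max - T z| + `|c ord_max| * (eps / k).
  apply: (le_trans (ler_normD _ _)); rewrite lerD2l normrZ ler_wpM2l//.
  by rewrite distrC ltW.
move=> /(ler_wpM2l s0) Xle; rewrite -lerBrDr; apply: (le_trans Xle).
rewrite mulrDr lerBrDr -addrA lerD2l.
have -> : s * (`|c ord_max| * (eps / k)) + `|c ord_max| * (eps / k) =
    eps * ((`|c ord_max| * (s + 1)) / k) by ring.
rewrite ler_piMr ?ltW// ltr_pdivrMr// mul1r /k ltrDl//.
Qed.

End GaussianMeasure.

(** * Stochastic extensions *)

Section StochasticExtension.
Context {R : realType} {H : completeNormedModType R} {ip : {dot H for idfun}}.
Hypothesis ip_norm : forall x, ip x x = `|x| ^+ 2.
Context {A T : H -> H} {e : nat -> H} {i : {linear H -> H}}.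
Hypothesis iW : wiener_embedding ip A e T i.
Context {z : nat -> H} (iz : forall k, i (z k) = e k).

Let ipP := ip_sip ip_norm.

Lemma embedding_dense : dense (range i).
Proof.
apply: approx_dense => x eps eps0.
have [_ [n _ [c ->]] xc] := dense_approx (we_basis iW).2 x eps0.
exists (\sum_(k < n) c k *: e k) => //; exists (\sum_(k < n) c k *: z k) => //.
by rewrite linear_sum; apply: eq_bigr => k _; rewrite linearZ iz.
Qed.

Context {h : R} {mu : probability (borel_space H) R} {ell : H -> borel_space H -> R}.
Hypothesis h_gt0 : 0 < h.
Hypothesis mu_gauss : is_gaussian_measure ip i h mu.
Hypothesis ellP : is_ell ip i mu ell.

Section ProjectionError.
Context {n : nat} (w : 'I_n -> H).

Let c k j := ip (T (z k)) (w j).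
Let g k (x : borel_space H) := \sum_(j < n) c k j * ell (w j) x - ip x (i (z k)).

Let mg k : measurable_fun [set: borel_space H] (g k).
Proof.
apply: measurable_funB; last exact: (measurable_dual ip_norm).
by apply: measurable_sum => j; apply: measurable_funM => //; exact: (measurable_ell ellP).
Qed.

Let gE k (x : borel_space H) : ip (i (pi_tilde ell w x) - (x : H)) (e k) = g k x.
Proof.
rewrite (sipBl ipP) -iz (we_adjoint iW) /pi_tilde (sip_suml ipP) /g; congr (_ - _).
by apply: eq_bigr => j _; rewrite (sipZl ipP) (sipC ipP) mulrC.
Qed.

(** Parseval reduces both the measurability and the integral of the error to its real coordinates
    [g k]. *)
Let normE (x : borel_space H) : (`|i (pi_tilde ell w x) - (x : H)| ^+ 2)%:E =
  (\sum_(0 <= k <oo) (g k x ^+ 2)%:E)%E.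
Proof.
apply/esym/cvg_lim; first exact: ereal_hausdorff.
rewrite (_ : (fun n => _) = EFin \o series (fun k => g k x ^+ 2)); last first.
  by apply/funext => m /=; rewrite seriesEnat sumEFin.
apply: cvg_EFin; first exact: nearW.
have := parseval ip_norm (i (pi_tilde ell w x) - (x : H)) (we_basis iW).
by under eq_fun do rewrite gE.
Qed.

Lemma measurable_projection_error : measurable_fun [set: borel_space H]
  (fun x : borel_space H => (`|i (pi_tilde ell w x) - (x : H)| ^+ 2)%:E).
Proof.
under eq_fun do rewrite normE.
apply: (@ge0_emeasurable_sum _ _ _ _ _ predT) => [k x _ _|k _].
  by rewrite lee_fin sqr_ge0.
by apply/measurable_EFinP; exact: measurable_funX.
Qed.

(** By [L2_norm_ell_sum], the [k]-th coordinate has second moment at most [8 * h] times the squared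
    distance from [T (z k)] to the span of [w]; the series is then summed term by term. *)
Lemma integral_projection_error (eps : R) :
  orthonormal_for ip w ->
  (forall K, \sum_(0 <= k < K) defect (ip := ip) w (T (z k)) <= eps) ->
  (\int[mu]_x (`|i (pi_tilde ell w x) - (x : H)| ^+ 2)%:E <= (8 * h * eps)%:E)%E.
Proof.
move=> won weps; under eq_integral do rewrite normE.
rewrite integral_nneseries//; last 2 first.
- by move=> k; apply/measurable_EFinP; exact: measurable_funX.
- by move=> k x _; rewrite lee_fin sqr_ge0.
apply: lime_le.
  by apply: is_cvg_nneseries => k _ _; apply: integral_ge0 => x _; rewrite lee_fin sqr_ge0.
apply: nearW => K.
apply: (@le_trans _ _ (\sum_(0 <= k < K) (8 * h * defect (ip := ip) w (T (z k)))%:E)%E).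
  apply: lee_sum => k _.
  have := L2_norm_ell_sum ip_norm iW h_gt0 mu_gauss ellP (c k) w (z k).
  move=> /L2_leP; rewrite mulr_ge0 ?sqrtr_ge0// => /(_ isT) /le_trans; apply.
  rewrite lee_fin exprMn sqr_sqrtr ?mulr_ge0 ?(ltW h_gt0)//.
  by rewrite (defectE ip_norm _ won) distrC.
by rewrite sumEFin lee_fin -mulr_sumr ler_wpM2l// mulr_ge0// ltW.
Qed.

End ProjectionError.

Context {f : H -> R} {fA : H -> R} {C : R}.
Hypothesis C_gt0 : 0 < C.
Hypothesis f_bounded : forall x, `|f x| <= C.
Hypothesis fA_ext : forall x, fA (i x) = f x.
Hypothesis fA_lip : forall b c, `|fA b - fA c| <= C * `|b - c|.

Let fA_bounded b : `|fA b| <= 2 * C.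
Proof.
(* A point of the range within distance 1 adds at most [C] to the bound [|f x| <= C]. *)
have [_ [x _ <-] bx] := dense_approx embedding_dense b ltr01.
have -> : fA b = (fA b - fA (i x)) + f x by rewrite fA_ext subrK.
apply: (le_trans (ler_normD _ _)); rewrite mulrDl mul1r lerD//.
by apply: (le_trans (fA_lip _ _)); rewrite ler_piMr ?ltW.
Qed.

Let measurable_fA : measurable_fun [set: borel_space H] (fA : borel_space H -> R).
Proof. by apply: continuous_borel_measurable; exact: lipschitz_continuous fA_lip. Qed.

(** [f] composed with [pi_tilde] is a Lipschitz function of the finitely many real variables
    [ell (w j)]. *)
Let measurable_f_pi n (w : 'I_n -> H) :
  measurable_fun [set: borel_space H] (f \o pi_tilde ell w).
Proof.
pose phi (c : 'I_n -> R) := f (\sum_(j < n) c j *: w j).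
apply: (@measurable_lipschitz_comp _ _ _ n (fun j => ell (w j)) phi
  (C * \sum_(j < n) `|i (w j)|)).
- by rewrite mulr_ge0 ?sumr_ge0// ltW.
- by move=> j; exact: (measurable_ell ellP).
move=> c c'; rewrite /phi -!fA_ext; apply: (le_trans (fA_lip _ _)).
rewrite -mulrA ler_wpM2l ?(ltW C_gt0)// -linearB -sumrB linear_sum.
apply: (le_trans (ler_norm_sum _ _ _)); rewrite mulr_sumr; apply: ler_sum => j _.
rewrite -scalerBl linearZ normrZ mulrC ler_wpM2r//.
by rewrite (bigD1 j)//= lerDl sumr_ge0.
Qed.

(** Since [f] is [fA] after [i], the error is at most [C] times the projection error, which tends to
    0 in [L^2]; its uniform bound [3 * C] upgrades this to [L^p] through [powR_le_delta]. *)
Lemma stochastic_extension_lipschitz (p : R) : 1 <= p ->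
  stochastic_extension ip mu ell p f fA.
Proof.
move=> p1; have p0 : 0 < p by exact: lt_le_trans p1.
split; first exact: (bounded_Lfun p1 measurable_fA fA_bounded).
move=> E d w Ew E_incr E_dense; split=> [m|].
  by apply: (@bounded_Lfun _ _ _ _ _ _ C) => // x; exact: f_bounded.
pose K := 3 * C; have K0 : 0 < K by rewrite mulr_gt0.
pose err m (x : borel_space H) := f (pi_tilde ell (w m) x) - fA x.
have errK m x : 0 <= `|err m x| <= K.
  rewrite normr_ge0/=; apply: (le_trans (ler_normB _ _)).
  rewrite (_ : K = C + 2 * C); last by rewrite /K; ring.
  exact: lerD.
have err_sqr m x : err m x ^+ 2 <= C ^+ 2 * `|i (pi_tilde ell (w m) x) - (x : H)| ^+ 2.
  rewrite -exprMn -[err m x ^+ 2]real_normK ?num_real// ler_pXn2r ?nnegrE ?mulr_ge0 ?(ltW C_gt0)//.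
  by rewrite /err -fA_ext fA_lip.
suff small (eps : R) : 0 < eps -> \forall m \near \oo,
    ('N[mu]_p%:E[EFin \o (err m)] <= eps%:E)%E.
  apply/fine_cvgP; split.
    apply: filterS (small 1 ltr01) => m m1.
    by rewrite ge0_fin_numE ?Lnorm_ge0// (le_lt_trans m1)// ltry.
  apply/cvgrPdist_le => eps eps0; apply: filterS (small eps eps0) => m meps.
  rewrite sub0r normrN /= ger0_norm ?fine_ge0 ?Lnorm_ge0//.
  rewrite -lee_fin fineK//.
  by rewrite ge0_fin_numE ?Lnorm_ge0// (le_lt_trans meps)// ltry.
move=> eps0; pose P := eps `^ p; have P0 : 0 < P by exact: powR_gt0.
(* Half of [eps ^ p] is spent on [delta ^ p]; [tol] is chosen so that the quadratic term takes the
   other half. *)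
pose delta := (P / 2) `^ p^-1.
have delta0 : 0 < delta by rewrite powR_gt0// divr_gt0.
have deltaE : delta `^ p = P / 2.
  by rewrite -powRrM mulVf ?gt_eqF// powRr1// ltW// divr_gt0.
pose b := K `^ p / delta ^+ 2 * C ^+ 2.
have b0 : 0 < b by rewrite mulr_gt0 ?exprn_gt0// divr_gt0 ?powR_gt0 ?exprn_gt0.
pose tol := P / 2 / (b * (8 * h)).
have tol0 : 0 < tol by rewrite !divr_gt0// mulr_gt0// mulr_gt0.
have := sum_defect_cvg ip_norm Ew E_incr E_dense
  (hilbert_schmidt_adjoint ip_norm iW iz) tol0.
apply: filterS => m mtol; apply/Lnorm_leP => //; first exact: ltW.
have [won _] := Ew m.
pose sq (x : borel_space H) := `|i (pi_tilde ell (w m) x) - (x : H)| ^+ 2.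
apply: (@le_trans _ _ (\int[mu]_x ((P / 2)%:E + b%:E * (sq x)%:E))%E).
  apply: le_integral_ge0 => x; first by rewrite lee_fin powR_ge0.
  rewrite -EFinM -EFinD lee_fin -deltaE.
  apply: (le_trans (powR_le_delta delta0 (errK m x) p1)); rewrite lerD2l.
  rewrite /b -[leRHS]mulrA real_normK ?num_real// ler_wpM2l//.
  by rewrite divr_ge0 ?powR_ge0 ?sqr_ge0.
have msq : measurable_fun [set: borel_space H] (fun x => (sq x)%:E).
  exact: measurable_projection_error.
have sq0 x : (0 <= (sq x)%:E)%E by rewrite lee_fin sqr_ge0.
rewrite ge0_integralD//; last 3 first.
- by move=> x _; rewrite lee_fin ltW// divr_gt0.
- by move=> x _; rewrite mule_ge0// lee_fin ltW.
- exact: emeasurable_funM.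
rewrite integral_cst// ge0_integralZl// ?lee_fin ?(ltW b0)//.
set one := (X in (_ * X + _)%E); have -> : one = 1%E by exact: probability_setT.
rewrite mule1 [X in (_ <= X%:E)%E](splitr P) EFinD leeD2l//.
apply: (@le_trans _ _ (b%:E * (8 * h * tol)%:E)%E).
  by rewrite lee_wpmul2l ?lee_fin ?(ltW b0)// integral_projection_error.
by rewrite -EFinM lee_fin /tol le_eqVlt; apply/orP; left; apply/eqP; field; rewrite !gt_eqF.
Qed.

(** Along the spans of the Hilbert basis, [ft] and [fA] are [L^p] limits of the same sequence, so
    Minkowski makes their distance 0. *)
Lemma stochastic_extension_unique (p : R) ft : 1 <= p ->
  stochastic_extension ip mu ell p f ft ->
  {ae mu, forall x, ft x = fA x}.
Proof.
move=> p1 [ftL ft_ext]; have [fAL fA_se] := stochastic_extension_lipschitz p1.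
have [span_on span_dense] := (orthonormal_basis_span (we_basis iW), (we_basis iW).2).
have [fL ft_cvg] := ft_ext _ _ _ span_on (@lspan_incr _ _ e) span_dense.
have [_ fA_cvg] := fA_se _ _ _ span_on (@lspan_incr _ _ e) span_dense.
set F := fun m => f \o pi_tilde ell (fun k : 'I_m => e k).
have mft := Lfun_measurable ftL; have mfA := Lfun_measurable fAL.
have mF m := Lfun_measurable (fL m).
have N0 : ('N[mu]_p%:E[EFin \o (ft \- fA)%R] = 0)%E.
  apply/eqP; rewrite eq_le Lnorm_ge0 andbT; apply/lee_addgt0Pr => eps eps0.
  rewrite add0e; have e2 : 0 < eps / 2 by rewrite divr_gt0.
  have small (u : (borel_space H -> R)) :
      ('N[mu]_p%:E[EFin \o (F m \- u)%R] @[m --> \oo] --> 0)%E ->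
      \forall m \near \oo, ('N[mu]_p%:E[EFin \o (F m \- u)%R] < (eps / 2)%:E)%E.
    move=> Fu; apply: (Fu [set x | (x < (eps / 2)%:E)%E]).
    apply: open_nbhs_nbhs; split; first exact: open_ereal_lt_ereal.
    by rewrite /= lte_fin.
  near \oo => m.
  rewrite (_ : (ft \- fA)%R = ((ft \- F m) \+ (F m \- fA))%R); last first.
    by apply/funext => x /=; rewrite subrKA.
  apply: (le_trans (minkowski_EFin _ _ _ p1)).
  - by apply: measurable_funB => //; exact: mF.
  - by apply: measurable_funB => //; exact: mF.
  rewrite (splitr eps) EFinD; apply: leeD; apply/ltW; last by near: m; exact: small.
  rewrite -[X in (X < _)%E]oppe_Lnorm.
  rewrite [X in ('N[_]_ _[X] < _)%E](_ : _ = EFin \o (F m \- ft)%R); last first.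
    by apply/funext => x /=; rewrite opprB.
  by near: m; exact: small.
have p0 : (0 < p%:E)%E by rewrite lte_fin; exact: lt_le_trans p1.
have mD : measurable_fun [set: borel_space H] (EFin \o (ft \- fA)%R).
  by apply/measurable_EFinP; exact: measurable_funB.
have := Lnorm_eq0_eq0 mD p0 N0; apply: filterS => x /= /(_ I) [] /eqP.
by rewrite subr_eq0 => /eqP.
Unshelve. all: by end_near. Qed.

End StochasticExtension.

Theorem proposition3p15 (R : realType) (H : completeNormedModType R)
    (ip : {dot H for idfun}) (ip_norm : forall x, ip x x = `|x| ^+ 2)
    (H_separable : separable_space H) (H_infinite : infinite_dimensional H)
    (A : {linear H -> H}) (A_continuous : continuous A)
    (A_selfadjoint : selfadjoint ip A)
    (A_nonnegative : nonnegative_operator ip A)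
    (A_trace_class : trace_class ip A) :
  exists N : H -> R, measurable_norm ip N /\
  exists (B : completeNormedModType R) (i : {linear H -> B}),
    is_completion N i /\
    forall f : H -> R, S_class (Qform ip A) f ->
      unif_continuous_wrt N f /\
      exists fA : B -> R,
        [/\ unif_continuous fA,
            forall x : H, fA (i x) = f x &
            forall (h p : R) (mu : probability (borel_space B) R)
              (ell : H -> borel_space B -> R),
              0 < h -> 1 <= p ->
              is_gaussian_measure ip i h mu -> is_ell ip i mu ell ->
              (exists ft, stochastic_extension ip mu ell p f ft) /\
              (forall ft, stochastic_extension ip mu ell p f ft ->
                 {ae mu, forall x, ft x = fA x})].
Proof.
have [e e_basis A_trace] := A_trace_class.
have [T [i iW]] := wiener_embedding_exists ip_norm A_continuous A_selfadjoint
  A_nonnegative e_basis A_trace.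
have [z iz] := choice (we_onto_basis iW).
exists (fun x => `|i x|); split; first exact: (measurable_embedding_norm ip_norm iW iz).
exists H, i; split; first by split=> //; exact: (embedding_dense iW iz).
move=> f /S_class_lipschitz[C C0 [fC f_lipQ]].
have f_lip x y : `|f x - f y| <= C * `|i x - i y|.
  (* [Q_A] at [x - y] is dominated by [|i (x - y)|^2], because [T] exceeds [A] by the nonnegative
     operator [D]. *)
  apply: (le_trans (f_lipQ x y)); rewrite ler_wpM2l ?(ltW C0)// -linearB.
  by rewrite -[leRHS]ger0_norm// -sqrtr_sqr ler_wsqrtr// (we_dominates iW).
split.
  move=> eps eps0; exists (eps / C) => [|x y]; first exact: divr_gt0.
  rewrite ltr_pdivlMr// linearB => xy; apply: le_lt_trans (f_lip x y) _.
  by rewrite mulrC.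
have [fA [fA_ext fA_lip]] := lipschitz_extension (ltW C0) fC f_lip.
exists fA; split=> //; first exact: lipschitz_unif_continuous fA_lip.
move=> h p mu ell h0 p1 mu_gauss ellP; split.
  exists fA.
  exact: (stochastic_extension_lipschitz ip_norm iW iz h0 mu_gauss ellP C0 fC fA_ext fA_lip p1).
move=> ft.
exact: (stochastic_extension_unique ip_norm iW iz h0 mu_gauss ellP C0 fC fA_ext fA_lip p1).
Qed.
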